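(* Let $M$ be a closed connected surface with a triangulation $\mathcal{T}=\{V,E,F\}$, $V=\{1,\dots,N\}$, let $I:E\to[0,+\infty)$ be an inversive distance, and let $\alpha\in\mathbb{R}$. Assume $\alpha\chi(M)\le 0$ and that there is a metric $r^*\in\Omega$ of constant $\alpha$-curvature. Then every solution $r(t)$ of the $\alpha$-flow $$\frac{du_i}{dt}=s_\alpha r_i^\alpha-K_i,\qquad u_i=\ln r_i,\ i\in V,$$ with $r(0)\in\Omega$ can be extended to a solution of the extended $\alpha$-flow $$\frac{du_i}{dt}=s_\alpha r_i^\alpha-\widetilde K_i,\qquad i\in V,$$ on $[0,+\infty)$ that converges exponentially fast to a constant $\alpha$-curvature metric (an element of $\Omega$) as $t\to+\infty$. That is, any solution $\{r(t)\mid t\in[0,+\infty)\}$ of the extended $\alpha$-flow converges exponentially fast to a metric of constant $\alpha$-curvature as $t\to+\infty$.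
   Context: $V,E,F$ are the vertices, edges and faces of $\mathcal{T}$, $N=|V|$. For $r\in\mathbb{R}^N_{>0}$ each edge $\{ij\}\in E$ gets length $l_{ij}=\sqrt{r_i^2+r_j^2+2r_ir_jI_{ij}}$. $\Omega$ is the set of all $r\in\mathbb{R}^N_{>0}$ such that for every face $\{ijk\}\in F$ the lengths $l_{ij},l_{jk},l_{ik}$ satisfy the three strict triangle inequalities; elements of $\Omega$ are called (inversive distance circle packing) metrics. For $r\in\Omega$, $\theta_i^{jk}$ is the inner angle at vertex $i$ of the Euclidean triangle $\{ijk\}$ with these edge lengths, and $K_i=2\pi-\sum_{\{ijk\}\in F}\theta_i^{jk}$ (sum over the triangles having $i$ as a vertex). The $\alpha$-curvature at $i$ is $R_{\alpha,i}=K_i/r_i^\alpha$; $r\in\Omega$ has constant $\alpha$-curvature if $R_{\alpha,i}$ is the same for all $i\in V$. For arbitrary $r\in\mathbb{R}^N_{>0}$ the generalized inner angles $\tilde\theta_i^{jk}$ of a face $\{ijk\}$ are: the Euclidean inner angles if the three strict triangle inequalities hold; and if $l_{jk}\ge l_{ij}+l_{ik}$ then $\tilde\theta_i^{jk}=\pi$ and the angles at $j$ and $k$ are $0$ (similarly for the other vertices). The extended curvature is $\widetilde K_i=2\pi-\sum_{\{ijk\}\in F}\tilde\theta_i^{jk}$, defined and continuous on $\mathbb{R}^N_{>0}$. $s_\alpha=2\pi\chi(M)/\|r\|_\alpha^\alpha$ with $\|r\|_\alpha^\alpha=\sum_{i=1}^N r_i^\alpha$. ''Converges exponentially fast to $\hat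 r$'' means $\|r(t)-\hat r\|\le Ce^{-ct}$ for all $t\ge0$, for some constants $C,c>0$. *)

(* Defs.v *)
From HB Require Import structures.
From mathcomp Require Import all_boot all_order all_algebra.
From mathcomp Require Import all_classical all_reals all_analysis.
Set Implicit Arguments.
Unset Strict Implicit.
Unset Printing Implicit Defensive.
Import Order.TTheory GRing.Theory Num.Theory.
Import numFieldNormedType.Exports.
Local Open Scope classical_set_scope.
Local Open Scope ring_scope.

(** A triangulated closed connected surface, as a finite simplicial complex on
    the vertex set ['I_N].  The realization of a 2-dimensional complex is a
    closed surface iff the link of every vertex is a cycle; since an edge
    [{ij}] lies in two faces iff [j] has degree two in the link of [i], this is
    what [edge_in_two_faces] and [link_connected] say together. *)
Record triangulation (N : nat) : Type := Triangulation {
  edges : {set {set 'I_N}};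
  faces : {set {set 'I_N}};
  vertex_nonempty : (0 < N)%N;
  face_card : forall f, f \in faces -> #|f| = 3;
  edgeP : forall e, e \in edges <->
            #|e| = 2 /\ (exists2 f, f \in faces & e \subset f);
  vertex_in_face : forall i, exists2 f, f \in faces & i \in f;
  edge_in_two_faces : forall e, e \in edges ->
            #|[set f in faces | e \subset f]| = 2;
  link_connected : forall i j k,
            [set i; j]%SET \in edges -> [set i; k]%SET \in edges ->
            connect [rel a b | [set i; a; b]%SET \in faces] j k;
  surface_connected : forall i j,
            connect [rel a b | [set a; b]%SET \in edges] i j
}.

Section CirclePacking.
Context {R : realType} {N : nat} (T : triangulation N).

Definition euler_char : int :=
  N%:Z - #|edges T|%:Z + #|faces T|%:Z.

Definition triangle_ineqs (a b c : R) : bool :=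
  [&& a < b + c, b < a + c & c < a + b].

(** Law of cosines: the angle opposite to the side [a] in the Euclidean
    triangle with sides [a], [b], [c]. *)
Definition inner_angle (a b c : R) : R :=
  acos ((b ^+ 2 + c ^+ 2 - a ^+ 2) / (2 * b * c)).

(** For positive [a], [b], [c] violating the strict triangle inequalities,
    exactly one of the sides is at least the sum of the two others. *)
Definition gen_inner_angle (a b c : R) : R :=
  if triangle_ineqs a b c then inner_angle a b c
  else if b + c <= a then pi else 0.

Definition positive_vec : set 'rV[R]_N := [set r | forall i, 0 < r 0 i].

(** The inversive distance is a function of the unordered pair [{ij}]; only
    its values on [edges T] are ever used. *)
Variable I : {set 'I_N} -> R.

Definition edge_length (r : 'rV[R]_N) (i j : 'I_N) : R :=
  Num.sqrt (r 0 i ^+ 2 + r 0 j ^+ 2 + 2 * r 0 i * r 0 j * I [set i; j]%SET).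

Definition Omega : set 'rV[R]_N :=
  [set r | positive_vec r /\
    forall i j k, [set i; j; k]%SET \in faces T ->
      triangle_ineqs (edge_length r j k) (edge_length r i j)
                     (edge_length r i k)].

(** [2 * pi] minus the angles at [i] of the faces [{ijk}]; the condition
    [j < k] makes each face containing [i] occur exactly once. *)
Definition angle_defect (angle : R -> R -> R -> R) (r : 'rV[R]_N) (i : 'I_N)
    : R :=
  2 * pi - \sum_(j < N) \sum_(k < N | (j < k)%N &&
                                      ([set i; j; k]%SET \in faces T))
             angle (edge_length r j k) (edge_length r i j) (edge_length r i k).

Definition curvature : 'rV[R]_N -> 'I_N -> R := angle_defect inner_angle.

Definition ext_curvature : 'rV[R]_N -> 'I_N -> R :=
  angle_defect gen_inner_angle.

Variable alpha : R.

Definition alpha_curvature (r : 'rV[R]_N) (i : 'I_N) : R :=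
  curvature r i / r 0 i `^ alpha.

Definition constant_alpha_curvature (r : 'rV[R]_N) : Prop :=
  Omega r /\ exists c : R, forall i, alpha_curvature r i = c.

Definition s_alpha (r : 'rV[R]_N) : R :=
  2 * pi * euler_char%:~R / \sum_(i < N) r 0 i `^ alpha.

(** [r] solves [d (ln r_i) / dt = X r i] on [[0, b)], with values in [D]; the
    derivative at [0] is one-sided, and [b] may be [+oo]. *)
Definition log_flow_solution (D : set 'rV[R]_N) (X : 'rV[R]_N -> 'I_N -> R)
    (b : \bar R) (r : R -> 'rV[R]_N) : Prop :=
  [/\ forall t : R, 0 <= t -> (t%:E < b)%E -> D (r t),
      forall (t : R) i, 0 < t -> (t%:E < b)%E ->
        is_derive t 1 (fun s : R => ln (r s 0 i)) (X (r t) i)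
    & forall i, h^-1 * (ln (r h 0 i) - ln (r 0 0 i)) @[h --> 0^'+]
                  --> X (r 0) i].

Definition alpha_flow_solution : \bar R -> (R -> 'rV[R]_N) -> Prop :=
  log_flow_solution Omega
    (fun r i => s_alpha r * r 0 i `^ alpha - curvature r i).

Definition ext_alpha_flow_solution : \bar R -> (R -> 'rV[R]_N) -> Prop :=
  log_flow_solution positive_vec
    (fun r i => s_alpha r * r 0 i `^ alpha - ext_curvature r i).

(** The norm is the library's sup norm on ['rV[R]_N]. *)
Definition converges_exponentially (r : R -> 'rV[R]_N) (rhat : 'rV[R]_N)
    : Prop :=
  exists C c : R, [/\ 0 < C, 0 < c &
    forall t, 0 <= t -> `|r t - rhat| <= C * expR (- (c * t))].

End CirclePacking.

(* Main.v *)
Require Import Defs.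
From HB Require Import structures.
From mathcomp Require Import all_boot all_order all_algebra.
From mathcomp Require Import all_classical all_reals all_analysis.
From mathcomp Require Import ring lra.
Import Order.TTheory GRing.Theory Num.Theory.
Import numFieldNormedType.Exports.
Local Open Scope classical_set_scope.
Local Open Scope ring_scope.

(** In the coordinates [u_i = ln r_i] the extended flow is an autonomous system
    [u' = X u].  The field [X] is bounded and continuous, it satisfies
    [sum_i X_i = 0] by Gauss--Bonnet ([flow_field_sum]), and it is dissipative:
    the pairing of [X u - X v] with [u - v] is never positive
    ([flow_field_dissipative]).

    These properties suffice for the global picture.  A bounded continuous
    field has global solutions ([peano]).  Dissipativity prevents two solutions
    from moving apart, so solutions are determined by their initial value and a
    solution of the flow inside [Omega] coincides with the global one for as
    long as it lasts.  The metric of constant curvature, rescaled so that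
    [sum_i ln r_i] takes its conserved value, is a zero [w] of [X], and the
    distance from a solution to [w] decreases.  On the ball of radius
    [|u 0 - w|] the pairing of [X v - X w] with [v - w] is at most
    [- c |v - w|^2] ([flow_field_coercive]), whence exponential convergence.

    Dissipativity has two sources.  The term [s_alpha r_i^alpha] is
    [2 pi chi] times the Gibbs weight of [alpha u], a monotone function, so
    [alpha chi <= 0] gives the right sign ([gibbs_dissipative]).  The curvature
    is treated triangle by triangle: the angles paired with a fixed direction
    [w] must decrease along the segment from [u] to [u + w].  For
    nondegenerate triangles the Jacobian of the angles is a product [B M],
    where [M] is the Jacobian of the logarithms of the edge lengths with
    respect to [u] and [B] that of the angles with respect to the logarithms of
    the edge lengths.  The form [B] is positive semidefinite with the constants
    as kernel, [B M] is symmetric, and [M] fixes the constants, has trace 0 and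
    determinant [d > 0] because the inversive distances are nonnegative.
    Modulo constants, Cayley--Hamilton reads [M^2 + M + d = 0], hence
    [<B M w, w> = - <B M w, M w> - d <B w, w>] ([angle_form_identity]), which
    is negative for nonconstant [w].  Where the segment crosses degenerate
    triangles all angles are 0 or [pi], so the pairing has finitely many
    possible values there, and a continuous function that is nonincreasing near
    every point outside finitely many of its values is nonincreasing
    ([nonincreasing_off_finite_values]).  The same computation with explicit
    constants gives the strict estimate near a nondegenerate triangle, and
    monotonicity along rays extends it to bounded sets
    ([tri_energy_coercive]); connectedness of the surface yields the Poincare
    inequality that sums these estimates up ([poincare]). *)

Set Implicit Arguments.
Unset Strict Implicit.

(** * The quadratic form of the angle variation *)

(** Here [q1], [q2], [q3] are the squared sides, [l1], [l2], [l3] the variations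
    of the logarithms of the sides when the logarithms of the radii vary by
    [w1], [w2], [w3], and [e1], [e2], [e3] the differences of squared radii.
    The left-hand side times [2 / sqrt (heron q1 q2 q3)] is the variation of
    the angles paired with [w].  With [M] the matrix sending
    [w] to [l] and [B] the form of the angle variation in terms of [l], the
    form [B M] is symmetric, while [M] has trace 0, fixes the constants and has
    determinant [d]; modulo constants its characteristic polynomial is
    [x^2 + x + d], so that [M = - M^2 - d], which is the right-hand side. *)
Lemma angle_form_identity (F : fieldType) (q1 q2 q3 e1 e2 w1 w2 w3 : F)
  (e3 := - e1 - e2)
  (l1 := ((q1 + e1) * w2 + (q1 - e1) * w3) / (2 * q1))
  (l2 := ((q2 + e2) * w3 + (q2 - e2) * w1) / (2 * q2))
  (l3 := ((q3 + e3) * w1 + (q3 - e3) * w2) / (2 * q3))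
  (p1 := (q2 + q3 - q1) / 2) (p2 := (q1 + q3 - q2) / 2)
  (p3 := (q1 + q2 - q3) / 2)
  (B := fun x1 x2 x3 : F => p3 * (x1 - x2) ^+ 2 + p1 * (x2 - x3) ^+ 2
     + p2 * (x1 - x3) ^+ 2)
  (d := (q1 + e1) / (2 * q1) * ((q2 + e2) / (2 * q2)) * ((q3 + e3) / (2 * q3)) +
   (q1 - e1) / (2 * q1) * ((q2 - e2) / (2 * q2)) * ((q3 - e3) / (2 * q3))) :
  (2 : F) != 0 -> q1 != 0 -> q2 != 0 -> q3 != 0 ->
  w1 * (q1 * l1 - p3 * l2 - p2 * l3) + w2 * (q2 * l2 - p3 * l1 - p1 * l3)
  + w3 * (q3 * l3 - p2 * l1 - p1 * l2) = - B l1 l2 l3 - d * B w1 w2 w3.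
Proof.
move=> two0 h1 h2 h3; rewrite /B /d /l1 /l2 /l3 /p1 /p2 /p3 /e3.
field.
by rewrite h1 h2 h3 two0.
Qed.

(** * Derivatives along the real line *)

Section Calculus.
Context {R : realType}.
Implicit Types (f g : R -> R) (t : R).

Lemma is_derive_fD f g t df dg : is_derive t 1 f df -> is_derive t 1 g dg ->
  is_derive t 1 (fun s => f s + g s) (df + dg).
Proof. exact: is_deriveD. Qed.

Lemma is_derive_fB f g t df dg : is_derive t 1 f df -> is_derive t 1 g dg ->
  is_derive t 1 (fun s => f s - g s) (df - dg).
Proof. exact: is_deriveB. Qed.

Lemma is_derive_fM f g t df dg : is_derive t 1 f df -> is_derive t 1 g dg ->
  is_derive t 1 (fun s => f s * g s) (f t * dg + df * g t).
Proof.
move=> hf hg; rewrite [df * _]mulrC.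
exact: (@is_deriveM _ _ f g t 1 df dg).
Qed.

Lemma is_derive_comp f g t df dg :
  is_derive (g t) 1 f df -> is_derive t 1 g dg ->
  is_derive t 1 (fun s => f (g s)) (df * dg).
Proof. exact: is_derive1_comp. Qed.

Lemma is_derive_const (c : R) t : is_derive t 1 (fun=> c) 0.
Proof. exact: is_derive_cst. Qed.

Lemma is_derive_fsum n (h : 'I_n -> R -> R) t (dh : 'I_n -> R) :
  (forall i, is_derive t 1 (h i) (dh i)) ->
  is_derive t 1 (fun s => \sum_(i < n) h i s) (\sum_(i < n) dh i).
Proof.
move=> H; rewrite (_ : (fun s => _) = \sum_(i < n) h i); last first.
  by apply/funext => s; rewrite fct_sumE.
exact: is_derive_sum.
Qed.

Lemma is_derive_cont f t df : is_derive t 1 f df -> {for t, continuous f}.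
Proof.
by move=> [d _]; apply: differentiable_continuous; apply/derivable1_diffP.
Qed.

Lemma derive_le0_nincr f df (a b : R) : a <= b ->
  (forall x, a < x < b -> is_derive x 1 f (df x) /\ df x <= 0) ->
  {within `[a, b], continuous f} -> f b <= f a.
Proof.
move=> ab H cf.
rewrite -subr_le0.
have [|c + ->] := @MVT_segment R f (fun x => if a < x < b then df x else 0) a b ab _ cf.
  by move=> x; rewrite in_itv /= => h; rewrite h; exact: (H x h).1.
move=> _; case: ifP => h; last by rewrite mul0r.
by apply: mulr_le0_ge0; [exact: (H c h).2|rewrite subr_ge0].
Qed.

(** If [f a < f b], pick a value [y] strictly between them and outside [s].
    Just after the last point of [[a, b]] where [f <= y], the function would
    exceed [y] although it is nonincreasing near that point. *)
Lemma nonincreasing_off_finite_values f (s : seq R) : continuous f ->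
  (forall t, f t \in s \/
     (\forall x \near t, exists2 d : R, is_derive (x : R) 1 f d & d <= 0)) ->
  forall a b, a <= b -> f b <= f a.
Proof.
move=> cf H a b; rewrite le_eqVlt => /predU1P[->//|ab].
rewrite leNgt; apply/negP => fab.
(* The midpoint between f a and the smallest value of s above it. *)
have [y /andP[ay yb] ys] : exists2 y, f a < y < f b & y \notin s.
  pose m := foldr Num.min (f b) [seq z <- s | f a < z].
  have am : f a < m.
    rewrite /m; elim: s {H m} => //= z s ih; case: ifP => //= az.
    by rewrite lt_min az.
  have mb : m <= f b.
    rewrite /m; elim: [seq z <- s | f a < z] => //= z s' ih.
    by rewrite ge_min ih orbT.
  have ms z : z \in s -> f a < z -> m <= z.
    move=> zs az; have: z \in [seq z <- s | f a < z] by rewrite mem_filter az.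
    rewrite /m; elim: [seq z <- s | f a < z] => //= z' s' ih.
    by rewrite inE ge_min => /predU1P[->|/ih ->]; rewrite ?lexx ?orbT.
  exists ((f a + m) / 2).
    by rewrite (midf_lt am).1 /= (lt_le_trans (midf_lt am).2 mb).
  apply/negP => /ms; rewrite (midf_lt am).1 => /(_ isT).
  by rewrite leNgt (midf_lt am).2.
pose A := [set x | a <= x <= b /\ f x <= y].
have Aa : A a by rewrite /A /= lexx (ltW ab) (ltW ay).
have ubA : ubound A b by move=> x /= [/andP[_]].
have supA : has_sup A by split; [exists a|exists b].
pose c := sup A.
have cub x : A x -> x <= c by move=> Ax; exact: sup_upper_bound.
have ac : a <= c by exact: cub.
have cb : c <= b := ge_sup (ex_intro A a Aa) ubA.
have fc : f c <= y.
  rewrite leNgt; apply/negP => yfc.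
  have : \forall x \near c, y < f x by exact: (cvgr_gt _ (cf c) _ yfc).
  move=> /nbhs_ballP[e /= e0 He].
  have [x Ax cx] := sup_adherent e0 supA.
  have xc : x <= c by exact: cub.
  have : y < f x.
    apply: He; rewrite /ball /= ger0_norm ?subr_ge0//.
    by rewrite ltrBlDl -ltrBlDr.
  by rewrite ltNge Ax.2.
have cltb : c < b.
  by rewrite lt_neqAle cb andbT; apply/eqP => cE; move: fc; rewrite cE leNgt yb.
have above x : c < x -> x <= b -> y < f x.
  move=> cx xb; rewrite ltNge; apply/negP => fx.
  have : x <= c.
    by apply: cub; split=> //; rewrite xb (le_trans ac (ltW cx)).
  by rewrite leNgt cx.
have fcy : y <= f c.
  rewrite leNgt; apply/negP => fcy.
  have : \forall x \near c, f x < y by exact: (cvgr_lt _ (cf c) _ fcy).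
  move=> /nbhs_ballP[e /= e0 He].
  pose x := Num.min (c + e / 2) b.
  have cx : c < x by rewrite lt_min cltb ltrDl divr_gt0.
  have xb : x <= b by rewrite ge_min lexx orbT.
  have xe : x <= c + e / 2 by rewrite ge_min lexx.
  have := above x cx xb; rewrite ltNge => /negP; apply; apply: ltW; apply: He.
  rewrite /ball /= distrC ger0_norm ?subr_ge0 ?(ltW cx)// ltrBlDl.
  by rewrite (le_lt_trans xe)// ltrD2l ltr_pdivrMr// ltr_pMr// ltrDl.
have {fc fcy} fcE : f c = y by apply/eqP; rewrite eq_le fc fcy.
case: (H c) => [|/nbhs_ballP[e /= e0 He]]; first by rewrite fcE (negbTE ys).
pose x := Num.min (c + e / 2) b.
have cx : c < x by rewrite lt_min cltb ltrDl divr_gt0.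
have xb : x <= b by rewrite ge_min lexx orbT.
have xe : x <= c + e / 2 by rewrite ge_min lexx.
have := above x cx xb; rewrite ltNge => /negP; apply; rewrite -fcE.
apply: (@derive_le0_nincr f (fun x => 'D_1 f x)) => //; first exact: ltW.
  move=> z /andP[cz zx].
  have [|d] := He z; last by move=> dz d0; rewrite (@derive_val _ _ _ _ _ _ _ dz).
  rewrite /ball /= distrC ger0_norm ?subr_ge0 ?(ltW cz)// ltrBlDl.
  rewrite (lt_le_trans zx)// (le_trans xe)// lerD2l ler_pdivrMr//.
  by rewrite ler_pMr// lerDl.
exact: continuous_subspaceT.
Qed.

End Calculus.

(** * Generalized angles as functions of squared side lengths *)

Section Angle.
Context {R : realType}.

Lemma acos_within_continuous : {within `[(-1)%R, 1%R], continuous (@acos R)}.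
Proof.
have := @segment_can_ge_continuous R 0 pi cos acos (pi_ge0 R) _ _.
rewrite cospi cos0; apply.
  exact/continuous_subspaceT/continuous_cos.
exact: cosK.
Qed.

Definition clamp (x : R) : R := Num.max (-1) (Num.min 1 x).

Lemma clamp_itv x : -1 <= clamp x <= 1.
Proof.
rewrite /clamp le_max lexx /= ge_max ge_min lexx /= andbT.
lra.
Qed.

Lemma clamp_id x : -1 <= x <= 1 -> clamp x = x.
Proof. by case/andP => h1 h2; rewrite /clamp min_r// max_r. Qed.

Lemma clamp_continuous : continuous clamp.
Proof.
move=> x.
have h : {for x, continuous ((fun=> 1 : R^o) \min (fun y : R => y : R^o))}.
  by apply: continuous_min; [exact: cst_continuous|exact: cvg_id].
have h' : {for x, continuous ((fun=> -1 : R^o) \max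
    ((fun=> 1 : R^o) \min (fun y : R => y : R^o)))}.
  by apply: continuous_max h; exact: cst_continuous.
exact: h'.
Qed.

(** Clamping the argument is what turns the angle of a nondegenerate triangle
    into the generalized one, see [gen_inner_angleE]; the continuity of [acos]
    up to the end points of its domain makes generalized angles continuous. *)
Lemma acos_clamp_continuous : continuous (fun x => acos (clamp x)).
Proof.
move=> x; have /subspace_continuousP/(_ (clamp x)) := acos_within_continuous.
rewrite /= in_itv /= clamp_itv => /(_ isT) H.
apply: cvg_comp H => U; rewrite /within /= => WU.
apply: (@filterS _ (nbhs x) _ _ _ _ (@clamp_continuous x _ WU)) => y /=; apply.
by rewrite in_itv /= clamp_itv.
Qed.

Definition cos_law (p q s : R) : R := (q + s - p) / (2 * Num.sqrt (q * s)).
(** Sixteen times the squared area, in terms of the squared sides; it is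
    positive exactly when the three strict triangle inequalities hold. *)
Definition heron (p q s : R) : R := 4 * q * s - (q + s - p) ^+ 2.
Definition ang (p q s : R) : R := acos (clamp (cos_law p q s)).

Lemma heron_rot p q s : heron q s p = heron p q s.
Proof. rewrite /heron; ring. Qed.

Lemma heron_swap p q s : heron p s q = heron p q s.
Proof. rewrite /heron; ring. Qed.

Lemma ang_swap p q s : ang p s q = ang p q s.
Proof. by rewrite /ang /cos_law (addrC s q) (mulrC s q). Qed.

Lemma cos_lawZ k p q s : 0 < k ->
  cos_law (k ^+ 2 * p) (k ^+ 2 * q) (k ^+ 2 * s) = cos_law p q s.
Proof.
move=> k0; rewrite /cos_law.
have -> : k ^+ 2 * q * (k ^+ 2 * s) = (k ^+ 2) ^+ 2 * (q * s) by ring.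
rewrite sqrtrM ?sqr_ge0// sqrtr_sqr ger0_norm ?sqr_ge0//.
rewrite -mulrDr -mulrBr mulrCA -mulf_div divff ?mul1r//.
by rewrite expf_neq0// gt_eqF.
Qed.

Lemma angZ k p q s : 0 < k ->
  ang (k ^+ 2 * p) (k ^+ 2 * q) (k ^+ 2 * s) = ang p q s.
Proof. by move=> k0; rewrite /ang cos_lawZ. Qed.

Lemma cos_law_sqr p q s : 0 < q -> 0 < s ->
  1 - cos_law p q s ^+ 2 = heron p q s / (4 * (q * s)).
Proof.
move=> q0 s0; rewrite /cos_law /heron expr_div_n exprMn sqr_sqrtr; last first.
  by rewrite mulr_ge0 // ltW.
by field; rewrite !gt_eqF.
Qed.

Lemma cos_law_bound p q s : 0 < q -> 0 < s -> 0 < heron p q s ->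
  -1 < cos_law p q s < 1.
Proof.
move=> q0 s0 h; rewrite -ltr_norml -(@ltr_pXn2r _ 2)// ?nnegrE//.
rewrite expr1n real_normK ?num_real// -subr_gt0 cos_law_sqr//.
by rewrite divr_gt0// !mulr_gt0.
Qed.

(** The finiteness of this set of values is all that the monotonicity argument
    needs to know about degenerate triangles. *)
Lemma ang_degenerate p q s : 0 < q -> 0 < s -> heron p q s <= 0 ->
  ang p q s = 0 \/ ang p q s = pi.
Proof.
move=> q0 s0 h.
have : 1 <= `|cos_law p q s|.
  rewrite -(@ler_pXn2r _ 2)// ?nnegrE// expr1n real_normK ?num_real//.
  by rewrite -subr_le0 cos_law_sqr// pmulr_lle0// invr_gt0 !mulr_gt0.
rewrite ler_normr /ang /clamp => /orP[h1|h1].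
  by left; rewrite min_l// max_r ?acos1//; lra.
by right; rewrite max_l ?acosN1// ge_min; apply/orP; right; lra.
Qed.

Lemma gen_inner_angleE a b c : 0 < a -> 0 < b -> 0 < c ->
  gen_inner_angle a b c = ang (a ^+ 2) (b ^+ 2) (c ^+ 2).
Proof.
move=> a0 b0 c0; rewrite /gen_inner_angle /ang.
have -> : cos_law (a ^+ 2) (b ^+ 2) (c ^+ 2) =
    (b ^+ 2 + c ^+ 2 - a ^+ 2) / (2 * b * c).
  by rewrite /cos_law -exprMn sqrtr_sqr ger0_norm ?mulrA// mulr_ge0// ltW.
have d0 : 0 < 2 * b * c by rewrite !mulr_gt0.
rewrite /triangle_ineqs /inner_angle; case: ifP => [/and3P[h1 h2 h3]|h].
  have := mulr_gt0 (_ : 0 < b + c - a) (_ : 0 < a + b + c).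
  have := mulr_gt0 (_ : 0 < a + c - b) (_ : 0 < a + b - c).
  rewrite !subr_gt0 !addr_gt0// => /(_ h2 h3) h23 /(_ h1 isT) h10.
  rewrite clamp_id// ler_pdivlMr// ler_pdivrMr//; nra.
case: ifP => h4.
  rewrite /clamp max_l ?acosN1// ge_min; apply/orP; right.
  have : 0 <= (a - (b + c)) * (a + b + c).
    by rewrite mulr_ge0 ?subr_ge0// ltW// !addr_gt0.
  by rewrite ler_pdivrMr//; nra.
rewrite /clamp min_l ?max_r ?acos1//.
rewrite ler_pdivlMr//.
have [h2|h2] := leP (a + c) b.
  have : 0 <= (b - (a + c)) * (b - c + a) by rewrite mulr_ge0//; lra.
  nra.
have [h3|h3] := leP (a + b) c.
  have : 0 <= (c - (a + b)) * (c - b + a) by rewrite mulr_ge0//; lra.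
  nra.
by move: h; rewrite h2 h3 ltNge h4.
Qed.

Lemma triangle_ineqs_heron a b c : 0 < a -> 0 < b -> 0 < c ->
  triangle_ineqs a b c = (0 < heron (a ^+ 2) (b ^+ 2) (c ^+ 2)).
Proof.
move=> a0 b0 c0.
have -> : heron (a ^+ 2) (b ^+ 2) (c ^+ 2) =
  (a + b + c) * ((b + c - a) * ((a + c - b) * (a + b - c))).
  by rewrite /heron; ring.
rewrite pmulr_rgt0 ?addr_gt0// /triangle_ineqs.
apply/idP/idP => [/and3P[h1 h2 h3]|h].
  by rewrite !mulr_gt0// subr_gt0.
case: (ltP a (b + c)) => h1; case: (ltP b (a + c)) => h2;
  case: (ltP c (a + b)) => h3 //=; exfalso; move: h; rewrite ltNge => /negP; apply.
- rewrite pmulr_rle0 ?subr_gt0// pmulr_rle0 ?subr_gt0//; lra.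
- rewrite pmulr_rle0 ?subr_gt0// pmulr_lle0 ?subr_gt0//; lra.
- lra.
- rewrite pmulr_lle0 ?mulr_gt0 ?subr_gt0//; lra.
- lra.
- lra.
- lra.
Qed.

End Angle.

(** * Variation and sum of the angles of a triangle *)

Section AngleDerivative.
Context {R : realType}.

(** The classical [dA = a (da - cos C db - cos B dc) / (2 area)], written with
    squared sides so that only one square root, four times the area, remains. *)
Lemma is_derive_ang (q1 q2 q3 : R -> R) (t d1 d2 d3 : R) :
  is_derive t 1 q1 d1 -> is_derive t 1 q2 d2 -> is_derive t 1 q3 d3 ->
  0 < q2 t -> 0 < q3 t -> 0 < heron (q1 t) (q2 t) (q3 t) ->
  is_derive t 1 (fun s => ang (q1 s) (q2 s) (q3 s))
    ((Num.sqrt (heron (q1 t) (q2 t) (q3 t)))^-1 *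
     (d1 - (q1 t + q2 t - q3 t) / 2 / q2 t * d2
         - (q1 t + q3 t - q2 t) / 2 / q3 t * d3)).
Proof.
move=> D1 D2 D3 q20 q30 h0.
have c1 := is_derive_cont D1; have c2 := is_derive_cont D2.
have c3 := is_derive_cont D3.
set P := Num.sqrt (q2 t * q3 t).
have P0 : 0 < P by rewrite sqrtr_gt0 mulr_gt0.
have Dden : is_derive t 1 (fun s => 2 * Num.sqrt (q2 s * q3 s))
    (2 * ((2 * P)^-1 * (q2 t * d3 + d2 * q3 t))).
  have Ds := @is_derive_comp R _ (fun s => q2 s * q3 s) t _ _
    (is_derive1_sqrt (mulr_gt0 q20 q30)) (is_derive_fM D2 D3).
  by have := is_derive_fM (is_derive_const (2 : R) t) Ds; rewrite mul0r addr0.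
have den0 : 2 * Num.sqrt (q2 t * q3 t) != 0 by rewrite gt_eqF// mulr_gt0.
have Dinv := @is_deriveV R (fun s => 2 * Num.sqrt (q2 s * q3 s)) t _ _ den0 Dden.
have Dcos := is_derive_fM (is_derive_fB (is_derive_fD D2 D3) D1) Dinv.
have cb := cos_law_bound q20 q30 h0.
have := @is_derive_comp R _ (fun s => cos_law (q1 s) (q2 s) (q3 s)) t _ _
  (is_derive1_acos cb) Dcos.
rewrite cos_law_sqr//.
set S := Num.sqrt (heron _ _ _).
have S0 : 0 < S by rewrite sqrtr_gt0.
have -> : Num.sqrt (heron (q1 t) (q2 t) (q3 t) / (4 * (q2 t * q3 t))) =
    S / (2 * P).
  rewrite sqrtrM ?(ltW h0)// sqrtrV ?mulr_ge0 ?(ltW q20) ?(ltW q30)//.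
  rewrite sqrtrM// -/P.
  by rewrite (_ : 4 = 2 ^+ 2 :> R) ?sqrtr_sqr ?ger0_norm//; ring.
move=> H.
have E : \forall s \near t, acos (cos_law (q1 s) (q2 s) (q3 s)) =
    ang (q1 s) (q2 s) (q3 s).
  have hc : (fun s => heron (q1 s) (q2 s) (q3 s)) @ t -->
      heron (q1 t) (q2 t) (q3 t).
    apply: cvgB.
      by apply: cvgM => //; apply: cvgM => //; exact: cvg_cst.
    by apply: cvgM; (apply: cvgB => //; apply: cvgD => //).
  have n2 := cvgr_gt _ c2 _ q20; have n3 := cvgr_gt _ c3 _ q30.
  have nh := cvgr_gt _ hc _ h0.
  near=> s; rewrite /ang clamp_id//.
  have : -1 < cos_law (q1 s) (q2 s) (q3 s) < 1.
    by apply: cos_law_bound; near: s; [exact: n2|exact: n3|exact: nh].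
  by case/andP => /ltW -> /ltW ->.
apply: near_eq_is_derive E _; apply: is_derive_eq H _.
rewrite -/P /GRing.scale /=.
have PE : q3 t = P ^+ 2 / q2 t.
  by rewrite sqr_sqrtr ?mulr_ge0// ?ltW// mulrAC divff ?mul1r// gt_eqF.
have P0' := lt0r_neq0 P0; have S0' := lt0r_neq0 S0; have q20' := lt0r_neq0 q20.
rewrite PE; field.
by rewrite P0' S0' q20'.
Unshelve. all: by end_near.
Qed.

(** The law of cosines gives [cos (A + B) = - cos C] and [sin (A + B) = sin C];
    positivity of the latter puts [A + B] below [pi], where cosine is
    injective. *)
Lemma angle_sum_nondegenerate (p q s : R) : 0 < p -> 0 < q -> 0 < s ->
  0 < heron p q s -> ang p q s + ang q s p + ang s p q = pi.
Proof.
move=> p0 q0 s0 h0.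
have hq : 0 < heron q s p by rewrite heron_rot.
have hs : 0 < heron s p q by rewrite -heron_rot.
have bp := cos_law_bound q0 s0 h0; have bq := cos_law_bound s0 p0 hq.
have bs := cos_law_bound p0 q0 hs.
have wk (x : R) : -1 < x < 1 -> -1 <= x <= 1 by move=> /andP[/ltW -> /ltW ->].
rewrite /ang !clamp_id ?wk//.
set A := acos _; set B := acos _; set C := acos _.
have sinE (x y z : R) : 0 < y -> 0 < z ->
    -1 < cos_law x y z < 1 -> heron x y z = heron p q s ->
    sin (acos (cos_law x y z)) = Num.sqrt (heron p q s) / (2 * Num.sqrt (y * z)).
  move=> y0 z0 b hE; rewrite sin_acos ?wk// cos_law_sqr// hE.
  rewrite sqrtrM ?(ltW h0)// sqrtrV ?mulr_ge0 ?(ltW y0) ?(ltW z0)//.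
  rewrite sqrtrM//.
  by rewrite (_ : 4 = 2 ^+ 2 :> R) ?sqrtr_sqr ?ger0_norm//; ring.
have sA := sinE _ _ _ q0 s0 bp erefl.
have sB := sinE _ _ _ s0 p0 bq (heron_rot _ _ _).
have sC := sinE _ _ _ p0 q0 bs (esym (heron_rot _ _ _)).
have itvE (x : R) : -1 < x < 1 -> x \in `[(-1), 1] by rewrite in_itv /=; exact: wk.
have cA : cos A = cos_law p q s by rewrite acosK// itvE.
have cB : cos B = cos_law q s p by rewrite acosK// itvE.
have cC : cos C = cos_law s p q by rewrite acosK// itvE.
have A0 : 0 < A < pi by case/andP: bp => h1 h2; rewrite acos_gt0 ?acos_ltpi// ?h1 ?h2 ltW.
have B0 : 0 < B < pi by case/andP: bq => h1 h2; rewrite acos_gt0 ?acos_ltpi// ?h1 ?h2 ltW.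
have C0 : 0 < C < pi by case/andP: bs => h1 h2; rewrite acos_gt0 ?acos_ltpi// ?h1 ?h2 ltW.
pose a := Num.sqrt p; pose b := Num.sqrt q; pose c := Num.sqrt s.
have a0 : 0 < a by rewrite sqrtr_gt0.
have b0 : 0 < b by rewrite sqrtr_gt0.
have c0 : 0 < c by rewrite sqrtr_gt0.
have pE : p = a ^+ 2 by rewrite sqr_sqrtr// ltW.
have qE : q = b ^+ 2 by rewrite sqr_sqrtr// ltW.
have sE : s = c ^+ 2 by rewrite sqr_sqrtr// ltW.
have nz := (lt0r_neq0 a0, lt0r_neq0 b0, lt0r_neq0 c0).
have SS : Num.sqrt (heron p q s) ^+ 2 = heron p q s by rewrite sqr_sqrtr// ltW.
have sAB : sin (A + B) = sin C.
  rewrite sinD sA sB sC cA cB /cos_law !sqrtrM ?(ltW q0) ?(ltW s0) ?(ltW p0)//.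
  rewrite -/a -/b -/c pE qE sE; field.
  by rewrite !nz.
have cAB : cos (A + B) = - cos C.
  rewrite cosD sA sB cA cB cC /cos_law !sqrtrM ?(ltW q0) ?(ltW s0) ?(ltW p0)//.
  rewrite [X in _ - X]mulf_div -expr2 SS /heron -/a -/b -/c pE qE sE; field.
  by rewrite !nz.
have sAB0 : 0 < sin (A + B) by rewrite sAB; apply: sin_gt0_pi; case/andP: C0 => -> ->.
have AB : A + B < pi.
  rewrite ltNge; apply/negP => piAB.
  have : 0 <= sin (A + B - pi).
    by apply: sin_ge0_pi; rewrite subr_ge0 piAB /=; lra.
  rewrite -[A + B - pi]/(A + B + - pi).
  have -> : sin (A + B - pi) = - sin (A + B).
    by rewrite -[in RHS](subrK pi (A + B)) sinDpi opprK.
  by rewrite oppr_ge0 leNgt sAB0.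
have : A + B = pi - C.
  apply: cos_inj; rewrite ?in_itv /=; [lra|lra|].
  by rewrite cAB (addrC pi) cosDpi cosN.
by move=> ->; rewrite subrK.
Qed.

Lemma angle_sum (p q s : R) : 0 < p -> 0 < q -> 0 < s ->
  ang p q s + ang q s p + ang s p q = pi.
Proof.
move=> p0 q0 s0; have [h|h] := ltP 0 (heron p q s).
  exact: angle_sum_nondegenerate.
pose a := Num.sqrt p; pose b := Num.sqrt q; pose c := Num.sqrt s.
have a0 : 0 < a by rewrite sqrtr_gt0.
have b0 : 0 < b by rewrite sqrtr_gt0.
have c0 : 0 < c by rewrite sqrtr_gt0.
have pE : p = a ^+ 2 by rewrite sqr_sqrtr// ltW.
have qE : q = b ^+ 2 by rewrite sqr_sqrtr// ltW.
have sE : s = c ^+ 2 by rewrite sqr_sqrtr// ltW.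
have t1 : triangle_ineqs a b c = false.
  by rewrite triangle_ineqs_heron// -pE -qE -sE ltNge h.
have t2 : triangle_ineqs b c a = false.
  by rewrite triangle_ineqs_heron// -pE -qE -sE heron_rot ltNge h.
have t3 : triangle_ineqs c a b = false.
  by rewrite triangle_ineqs_heron// -pE -qE -sE -heron_rot ltNge h.
rewrite pE qE sE -!gen_inner_angleE// /gen_inner_angle t1 t2 t3.
case: ifP => h1; case: ifP => h2; case: ifP => h3; try lra.
by move: t1; rewrite /triangle_ineqs; case: ltP => //; case: ltP => //; case: ltP => //; lra.
Qed.

End AngleDerivative.

(** * Monotonicity of the angles of one triangle *)

Section QuadraticBound.
Context {R : realFieldType}.
Variables (q1 q2 q3 : R).
Hypotheses (q1_gt0 : 0 < q1) (q2_gt0 : 0 < q2) (q3_gt0 : 0 < q3).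
Let p1 := (q2 + q3 - q1) / 2.
Let p2 := (q1 + q3 - q2) / 2.
Let p3 := (q1 + q2 - q3) / 2.
Let B x1 x2 x3 :=
  p3 * (x1 - x2) ^+ 2 + p1 * (x2 - x3) ^+ 2 + p2 * (x1 - x3) ^+ 2.
Let H := 4 * q2 * q3 - (q2 + q3 - q1) ^+ 2.

(** Completing the square: after eliminating one variable the form [B] has
    discriminant [- H], where [H] is sixteen times the squared area. *)
Lemma side_form_ge x1 x2 x3 :
  [/\ H * (x1 - x3) ^+ 2 <= 4 * q2 * B x1 x2 x3,
      H * (x2 - x3) ^+ 2 <= 4 * q1 * B x1 x2 x3 &
      H * (x1 - x2) ^+ 2 <= 4 * q3 * B x1 x2 x3].
Proof.
split; rewrite -subr_ge0.
- have -> : 4 * q2 * B x1 x2 x3 - H * (x1 - x3) ^+ 2 =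
    (2 * (q2 * (x2 - x3) - p3 * (x1 - x3))) ^+ 2.
    by rewrite /B /H /p1 /p2 /p3; field.
  exact: sqr_ge0.
- have -> : 4 * q1 * B x1 x2 x3 - H * (x2 - x3) ^+ 2 =
    (2 * (q1 * (x1 - x3) - p3 * (x2 - x3))) ^+ 2.
    by rewrite /B /H /p1 /p2 /p3; field.
  exact: sqr_ge0.
- have -> : 4 * q3 * B x1 x2 x3 - H * (x1 - x2) ^+ 2 =
    (2 * (q3 * (x3 - x2) - p2 * (x1 - x2))) ^+ 2.
    by rewrite /B /H /p1 /p2 /p3; field.
  exact: sqr_ge0.
Qed.

Lemma side_form_lower x1 x2 x3 :
  H * ((x1 - x2) ^+ 2 + (x2 - x3) ^+ 2 + (x1 - x3) ^+ 2) <=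
  4 * (q1 + q2 + q3) * B x1 x2 x3.
Proof. by have [h1 h2 h3] := side_form_ge x1 x2 x3; nra. Qed.

Lemma side_form_ge0 x1 x2 x3 : 0 <= H -> 0 <= B x1 x2 x3.
Proof.
move=> H0; have [h1 _ _] := side_form_ge x1 x2 x3.
rewrite -(@pmulr_rge0 _ (4 * q2)) ?mulr_gt0//.
by apply: le_trans h1; rewrite mulr_ge0// sqr_ge0.
Qed.

End QuadraticBound.

Section Triangle.
Context {R : realType}.

Definition sqlen (I x y : R) : R :=
  expR x ^+ 2 + expR y ^+ 2 + 2 * expR x * expR y * I.

Lemma sqlen_gt0 I x y : 0 <= I -> 0 < sqlen I x y.
Proof.
move=> I0; apply: ltr_wpDr; first by rewrite !mulr_ge0// expR_ge0.
by rewrite addr_gt0// exprn_gt0// expR_gt0.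
Qed.

Lemma sqlenC I x y : sqlen I x y = sqlen I y x.
Proof. by rewrite /sqlen; ring. Qed.

Lemma sqlenD c I x y : sqlen I (x + c) (y + c) = expR c ^+ 2 * sqlen I x y.
Proof. by rewrite /sqlen !expRD; ring. Qed.

Lemma cvg_sqlen {T : Type} (F : set_system T) {FF : Filter F} I (f g : T -> R) (a b : R) :
  f @ F --> a -> g @ F --> b ->
  (fun z => sqlen I (f z) (g z)) @ F --> sqlen I a b.
Proof.
move=> fa gb.
have Ef : (fun z => expR (f z)) @ F --> expR a.
  by apply: (cvg_comp f expR fa); exact: continuous_expR.
have Eg : (fun z => expR (g z)) @ F --> expR b.
  by apply: (cvg_comp g expR gb); exact: continuous_expR.
apply: cvgD; first by apply: cvgD; rewrite !expr2; apply: cvgM.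
by apply: cvgM; [apply: cvgM => //; apply: cvgM => //|]; exact: cvg_cst.
Qed.

Lemma cvg_heron {T : Type} (F : set_system T) {FF : Filter F}
    (p q s : T -> R) (p0 q0 s0 : R) :
  p @ F --> p0 -> q @ F --> q0 -> s @ F --> s0 ->
  (fun z => heron (p z) (q z) (s z)) @ F --> heron p0 q0 s0.
Proof.
move=> hp hq hs; apply: cvgB.
  by apply: cvgM => //; apply: cvgM => //; exact: cvg_cst.
by apply: cvgM; (apply: cvgB => //; apply: cvgD => //).
Qed.

Lemma cvg_sqrt {T : Type} (F : set_system T) {FF : Filter F} (p : T -> R) (p0 : R) :
  p @ F --> p0 -> (fun z => Num.sqrt (p z)) @ F --> Num.sqrt p0.
Proof. by move=> h; apply: (cvg_comp p Num.sqrt h); exact: sqrt_continuous. Qed.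

Lemma cvg_ang {T : Type} (F : set_system T) {FF : Filter F}
    (p q s : T -> R) (p0 q0 s0 : R) :
  0 < q0 -> 0 < s0 ->
  p @ F --> p0 -> q @ F --> q0 -> s @ F --> s0 ->
  (fun z => ang (p z) (q z) (s z)) @ F --> ang p0 q0 s0.
Proof.
move=> q0_gt0 s0_gt0 hp hq hs.
apply: (cvg_comp (fun z => cos_law (p z) (q z) (s z)) (fun x => acos (clamp x)));
  last exact: acos_clamp_continuous.
apply: cvgM; first by apply: cvgB => //; apply: cvgD.
apply: cvgV; first by rewrite gt_eqF// mulr_gt0// sqrtr_gt0 mulr_gt0.
apply: cvgM; first exact: cvg_cst.
by apply: cvg_sqrt; apply: cvgM.
Qed.

Lemma is_derive_line (x w t : R) : is_derive t 1 (fun s => x + s * w) w.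
Proof.
have D := is_derive_fD (is_derive_const x t)
  (is_derive_fM (is_derive_id t 1) (is_derive_const w t)).
by apply: is_derive_eq D _; rewrite mulr0 mul1r !add0r.
Qed.

Lemma is_derive_sqlen I x y w v t
  (a := expR (x + t * w)) (b := expR (y + t * v)) :
  is_derive t 1 (fun s => sqlen I (x + s * w) (y + s * v))
    (2 * ((a ^+ 2 + a * b * I) * w + (b ^+ 2 + a * b * I) * v)).
Proof.
have Da : is_derive t 1 (fun s => expR (x + s * w)) (a * w).
  exact: (@is_derive_comp _ _ (fun s => x + s * w) t _ _ (is_derive_expR _)
    (is_derive_line _ _ _)).
have Db : is_derive t 1 (fun s => expR (y + s * v)) (b * v).
  exact: (@is_derive_comp _ _ (fun s => y + s * v) t _ _ (is_derive_expR _)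
    (is_derive_line _ _ _)).
have D := is_derive_fD (is_derive_fD (is_derive_fM Da Da) (is_derive_fM Db Db))
  (is_derive_fM (is_derive_fM (is_derive_fM (is_derive_const (2 : R) t) Da) Db)
    (is_derive_const I t)).
apply: is_derive_eq D _.
by rewrite -/a -/b; ring.
Qed.

Variables (I1 I2 I3 : R).
Hypotheses (I1_ge0 : 0 <= I1) (I2_ge0 : 0 <= I2) (I3_ge0 : 0 <= I3).

Definition angle1 x1 x2 x3 := ang (sqlen I1 x2 x3) (sqlen I2 x3 x1) (sqlen I3 x1 x2).
Definition angle2 x1 x2 x3 := ang (sqlen I2 x3 x1) (sqlen I3 x1 x2) (sqlen I1 x2 x3).
Definition angle3 x1 x2 x3 := ang (sqlen I3 x1 x2) (sqlen I1 x2 x3) (sqlen I2 x3 x1).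
Definition tri_heron x1 x2 x3 :=
  heron (sqlen I1 x2 x3) (sqlen I2 x3 x1) (sqlen I3 x1 x2).

(** The partial derivative of the logarithm of the edge length with respect to
    the logarithm of the first radius. *)
Definition share (I x y : R) : R :=
  (expR x ^+ 2 + expR x * expR y * I) / sqlen I x y.

Lemma share_gt0 I x y : 0 <= I -> 0 < share I x y.
Proof.
move=> I0; rewrite divr_gt0 ?sqlen_gt0//; apply: ltr_wpDr.
  by rewrite !mulr_ge0// expR_ge0.
by rewrite exprn_gt0// expR_gt0.
Qed.

(** The determinant of the Jacobian of the logarithms of the edge lengths with
    respect to the logarithms of the radii. *)
Definition tri_det x1 x2 x3 :=
  share I1 x2 x3 * share I2 x3 x1 * share I3 x1 x2 +
  share I1 x3 x2 * share I2 x1 x3 * share I3 x2 x1.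

(** A lower bound for the rate at which the angles decrease; it is continuous
    and, like the area, positive exactly for nondegenerate triangles. *)
Definition coercivity x1 x2 x3 :=
  Num.sqrt (tri_heron x1 x2 x3) * tri_det x1 x2 x3 /
  (2 * (sqlen I1 x2 x3 + sqlen I2 x3 x1 + sqlen I3 x1 x2)).

Lemma tri_det_gt0 x1 x2 x3 : 0 < tri_det x1 x2 x3.
Proof.
by apply: addr_gt0; (apply: mulr_gt0; [apply: mulr_gt0|]); exact: share_gt0.
Qed.

Lemma coercivity_gt0 x1 x2 x3 :
  (0 < coercivity x1 x2 x3) = (0 < tri_heron x1 x2 x3).
Proof.
rewrite /coercivity pmulr_lgt0; last first.
  rewrite invr_gt0; apply: mulr_gt0 => //.
  by apply: addr_gt0; [apply: addr_gt0|]; exact: sqlen_gt0.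
by rewrite pmulr_lgt0 ?tri_det_gt0// sqrtr_gt0.
Qed.

(** The negative definiteness modulo constants of the Jacobian of the angles:
    up to a positive factor, [angle_form_identity] makes the derivative at most
    [- d] times the form [B], which is bounded below by [side_form_lower]. *)
Lemma is_derive_angle_energy x1 x2 x3 w1 w2 w3 t :
  0 < tri_heron (x1 + t * w1) (x2 + t * w2) (x3 + t * w3) ->
  exists2 d : R,
    is_derive t 1 (fun s =>
      w1 * angle1 (x1 + s * w1) (x2 + s * w2) (x3 + s * w3) +
      w2 * angle2 (x1 + s * w1) (x2 + s * w2) (x3 + s * w3) +
      w3 * angle3 (x1 + s * w1) (x2 + s * w2) (x3 + s * w3)) d &
    d <= - (coercivity (x1 + t * w1) (x2 + t * w2) (x3 + t * w3) *
            ((w1 - w2) ^+ 2 + (w2 - w3) ^+ 2 + (w1 - w3) ^+ 2)).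
Proof.
move=> h0.
have D1 := is_derive_sqlen I1 x2 x3 w2 w3 t.
have D2 := is_derive_sqlen I2 x3 x1 w3 w1 t.
have D3 := is_derive_sqlen I3 x1 x2 w1 w2 t.
have q10 := sqlen_gt0 (x2 + t * w2) (x3 + t * w3) I1_ge0.
have q20 := sqlen_gt0 (x3 + t * w3) (x1 + t * w1) I2_ge0.
have q30 := sqlen_gt0 (x1 + t * w1) (x2 + t * w2) I3_ge0.
have h1 : 0 < heron (sqlen I2 (x3 + t * w3) (x1 + t * w1))
  (sqlen I3 (x1 + t * w1) (x2 + t * w2)) (sqlen I1 (x2 + t * w2) (x3 + t * w3)).
  by rewrite heron_rot.
have h2 : 0 < heron (sqlen I3 (x1 + t * w1) (x2 + t * w2))
  (sqlen I1 (x2 + t * w2) (x3 + t * w3)) (sqlen I2 (x3 + t * w3) (x1 + t * w1)).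
  by rewrite -heron_rot.
have A1 := is_derive_ang D1 D2 D3 q20 q30 h0.
have A2 := is_derive_ang D2 D3 D1 q30 q10 h1.
have A3 := is_derive_ang D3 D1 D2 q10 q20 h2.
have DD := is_derive_fD (is_derive_fD
  (is_derive_fM (is_derive_const w1 t) A1)
  (is_derive_fM (is_derive_const w2 t) A2))
  (is_derive_fM (is_derive_const w3 t) A3).
eexists; first exact: DD.
rewrite (heron_rot (sqlen I1 _ _) (sqlen I2 _ _) (sqlen I3 _ _)).
rewrite -(heron_rot (sqlen I3 _ _) (sqlen I1 _ _) (sqlen I2 _ _)).
rewrite /coercivity /tri_det /share (sqlenC I1 (x3 + t * w3)) (sqlenC I2 (x1 + t * w1)).
rewrite (sqlenC I3 (x2 + t * w2)).
move: h0 q10 q20 q30; rewrite -/(tri_heron _ _ _) {h1 h2 A1 A2 A3 DD D1 D2 D3}.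
rewrite /tri_heron.
set r1 := expR (x1 + _); set r2 := expR (x2 + _); set r3 := expR (x3 + _).
set q1 := sqlen I1 _ _; set q2 := sqlen I2 _ _; set q3 := sqlen I3 _ _.
have e1 : r2 ^+ 2 + r2 * r3 * I1 = (q1 + (r2 ^+ 2 - r3 ^+ 2)) / 2.
  by rewrite /q1 /sqlen -/r2 -/r3; field.
have e1' : r3 ^+ 2 + r2 * r3 * I1 = (q1 - (r2 ^+ 2 - r3 ^+ 2)) / 2.
  by rewrite /q1 /sqlen -/r2 -/r3; field.
have e2 : r3 ^+ 2 + r3 * r1 * I2 = (q2 + (r3 ^+ 2 - r1 ^+ 2)) / 2.
  by rewrite /q2 /sqlen -/r1 -/r3; field.
have e2' : r1 ^+ 2 + r3 * r1 * I2 = (q2 - (r3 ^+ 2 - r1 ^+ 2)) / 2.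
  by rewrite /q2 /sqlen -/r1 -/r3; field.
have e3 : r1 ^+ 2 + r1 * r2 * I3 =
    (q3 + (- (r2 ^+ 2 - r3 ^+ 2) - (r3 ^+ 2 - r1 ^+ 2))) / 2.
  by rewrite /q3 /sqlen -/r1 -/r2; field.
have e3' : r2 ^+ 2 + r1 * r2 * I3 =
    (q3 - (- (r2 ^+ 2 - r3 ^+ 2) - (r3 ^+ 2 - r1 ^+ 2))) / 2.
  by rewrite /q3 /sqlen -/r1 -/r2; field.
rewrite (mulrC r3 r2) (mulrC r1 r3) (mulrC r2 r1) e1 e1' e2 e2' e3 e3'.
move=> h0 q10 q20 q30.
have d0 : 0 < tri_det (x1 + t * w1) (x2 + t * w2) (x3 + t * w3) by exact: tri_det_gt0.
move: d0; rewrite /tri_det /share (sqlenC I1 (x3 + t * w3)) (sqlenC I2 (x1 + t * w1)).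
rewrite (sqlenC I3 (x2 + t * w2)) -/r1 -/r2 -/r3 -/q1 -/q2 -/q3.
rewrite (mulrC r3 r2) (mulrC r1 r3) (mulrC r2 r1) e1 e1' e2 e2' e3 e3'.
move: h0 q10 q20 q30.
move: (r2 ^+ 2 - r3 ^+ 2) (r3 ^+ 2 - r1 ^+ 2) => E1 E2 {e1 e1' e2 e2' e3 e3'}.
move: {r1 r2 r3} q1 q2 q3 => q1 q2 q3 h0 q10 q20 q30.
set S := Num.sqrt (heron q1 q2 q3).
have S0 : 0 < S by rewrite sqrtr_gt0.
set d := (X in 0 < X -> _) => d0.
have two0 : (2 : R) != 0 by [].
have nz := (lt0r_neq0 S0, lt0r_neq0 q10, lt0r_neq0 q20, lt0r_neq0 q30).
have formE := angle_form_identity E1 E2 w1 w2 w3 two0 (lt0r_neq0 q10) (lt0r_neq0 q20) (lt0r_neq0 q30).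
set G := (X in X <= _).
move: formE; set L := (X in X = _) => formE.
have -> : G = 2 / S * L by rewrite /G /L; field; rewrite !nz.
rewrite {G L}formE.
set B1 := (X in - X - _); set D := (X in _ <= - (_ * X)).
have B1_ge0 : 0 <= B1 by apply: (side_form_ge0 q20 _ _ _ (ltW h0)).
set B2 := (X in - B1 - _ * X).
have B2_ge : S ^+ 2 * D <= 4 * (q1 + q2 + q3) * B2.
  by rewrite sqr_sqrtr ?(ltW h0)//; exact: side_form_lower.
have T0 : 0 < q1 + q2 + q3 by rewrite !addr_gt0.
set d1 := (X in - B1 - X * _).
have -> : d1 = d by rewrite /d1 /d; field; rewrite !nz.
rewrite -/d; move: {d1} d d0 => d d0.
have key : S * d / (2 * (q1 + q2 + q3)) * D <= 2 / S * (d * B2).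
  have -> : S * d / (2 * (q1 + q2 + q3)) * D =
      d / (2 * (q1 + q2 + q3) * S) * (S ^+ 2 * D).
    by field; rewrite (lt0r_neq0 T0) !nz.
  have -> : 2 / S * (d * B2) =
      d / (2 * (q1 + q2 + q3) * S) * (4 * (q1 + q2 + q3) * B2).
    by field; rewrite (lt0r_neq0 T0) !nz.
  by rewrite ler_wpM2l// divr_ge0 ?(ltW d0)// !mulr_ge0// ?(ltW S0)// ltW.
have B1S : 0 <= 2 / S * B1 by rewrite mulr_ge0// divr_ge0// ltW.
by rewrite mulrBr mulrN; lra.
Qed.

(** The derivative, in the direction [w], of the concave potential whose
    gradient is the triple of angles. *)
Definition tri_energy w1 w2 w3 x1 x2 x3 :=
  w1 * angle1 x1 x2 x3 + w2 * angle2 x1 x2 x3 + w3 * angle3 x1 x2 x3.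

Lemma cvg_line (x w t : R) : (fun s => x + s * w) @ t --> x + t * w.
Proof. exact: (is_derive_cont (is_derive_line x w t)). Qed.

Lemma tri_energy_continuous_line (x1 x2 x3 w1 w2 w3 : R) : continuous (fun s : R =>
  tri_energy w1 w2 w3 (x1 + s * w1) (x2 + s * w2) (x3 + s * w3)).
Proof.
move=> t; rewrite /tri_energy /angle1 /angle2 /angle3.
by apply: cvgD; first apply: cvgD; apply: cvgM; try exact: cvg_cst;
  apply: cvg_ang; try exact: sqlen_gt0; apply: cvg_sqlen; exact: cvg_line.
Qed.

Lemma tri_heron_continuous_line (x1 x2 x3 w1 w2 w3 : R) : continuous (fun s : R =>
  tri_heron (x1 + s * w1) (x2 + s * w2) (x3 + s * w3)).
Proof.
by move=> t; apply: cvg_heron; apply: cvg_sqlen; exact: cvg_line.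
Qed.

(** Along the segment the pairing is continuous; where the triangle is
    nondegenerate it decreases, and elsewhere each angle is 0 or [pi], so that
    only eight values are possible. *)
Lemma tri_energy_nincr x1 x2 x3 w1 w2 w3 :
  tri_energy w1 w2 w3 (x1 + w1) (x2 + w2) (x3 + w3) <=
  tri_energy w1 w2 w3 x1 x2 x3.
Proof.
have Pi := nonincreasing_off_finite_values (s :=
  allpairs (fun a b => w1 * a + b) [:: 0; pi]
    (allpairs (fun b c => w2 * b + w3 * c) [:: 0; pi] [:: 0; pi]))
  (@tri_energy_continuous_line x1 x2 x3 w1 w2 w3).
have := Pi _ 0 1 ler01; rewrite !mul1r !mul0r !addr0; apply => {Pi} t.
have [h|h] := ltP 0 (tri_heron (x1 + t * w1) (x2 + t * w2) (x3 + t * w3)).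
  right; have N := cvgr_gt _ (@tri_heron_continuous_line x1 x2 x3 w1 w2 w3 t) _ h.
  near=> s.
  have hs : 0 < tri_heron (x1 + s * w1) (x2 + s * w2) (x3 + s * w3).
    by near: s; exact: N.
  have [d Dd d_le] := is_derive_angle_energy hs.
  exists d => //; apply: le_trans d_le _; rewrite oppr_le0.
  by rewrite mulr_ge0// ?addr_ge0// ?sqr_ge0// ltW// coercivity_gt0.
left; rewrite /tri_energy -addrA.
have mem (x : R) : x = 0 \/ x = pi -> x \in [:: 0; pi].
  by rewrite !inE => -[->|->]; rewrite eqxx ?orbT.
apply: (@allpairs_f _ _ _ (fun a b => w1 * a + b)).
  by apply: mem; apply: ang_degenerate h; exact: sqlen_gt0.
apply: (@allpairs_f _ _ _ (fun b c => w2 * b + w3 * c)); apply: mem;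
    apply: ang_degenerate; try exact: sqlen_gt0.
  by rewrite heron_rot.
by rewrite -heron_rot.
Unshelve. all: by end_near.
Qed.

(** When the whole segment stays in a region of bounded coercivity, the mean
    value theorem gives quadratic decrease. *)
Lemma tri_energy_decr (x1 x2 x3 w1 w2 w3 k : R) :
  (forall s, 0 <= s <= 1 ->
     k <= coercivity (x1 + s * w1) (x2 + s * w2) (x3 + s * w3)) -> 0 < k ->
  tri_energy w1 w2 w3 (x1 + w1) (x2 + w2) (x3 + w3) <=
  tri_energy w1 w2 w3 x1 x2 x3 -
  k * ((w1 - w2) ^+ 2 + (w2 - w3) ^+ 2 + (w1 - w3) ^+ 2).
Proof.
move=> Hk k0; set D := (X in k * X).
have D0 : 0 <= D by rewrite !addr_ge0// sqr_ge0.
pose g (s : R) : R := tri_energy w1 w2 w3 (x1 + s * w1) (x2 + s * w2) (x3 + s * w3).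
have dg (s : R) : 0 <= s <= 1 -> exists2 d : R, is_derive s 1 g d & d <= - (k * D).
  move=> hs; have hk := Hk s hs.
  have [|d Dd d_le] := @is_derive_angle_energy x1 x2 x3 w1 w2 w3 s.
    by rewrite -coercivity_gt0 (lt_le_trans k0).
  by exists d => //; apply: le_trans d_le _; rewrite lerN2 ler_wpM2r.
suff : g 1 + 1 * (k * D) <= g 0 + 0 * (k * D).
  by rewrite /g !mul1r !mul0r !addr0 lerBrDr.
apply: (@derive_le0_nincr R (fun s => g s + s * (k * D))
  (fun s => 'D_1 g s + k * D) 0 1 ler01).
  move=> s /andP[s0 s1]; have [|d Dd d_le] := dg s; first by rewrite !ltW.
  split; last by rewrite (@derive_val _ _ _ _ _ _ _ Dd); lra.
  have E := is_derive_fD Dd (is_derive_fM (is_derive_id s 1) (is_derive_const (k * D) s)).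
  apply: is_derive_eq E _.
  by rewrite (@derive_val _ _ _ _ _ _ _ Dd) mulr0 add0r mul1r.
apply: continuous_subspaceT => s; apply: cvgD; first exact: tri_energy_continuous_line.
by apply: cvgM; [exact: cvg_id|exact: cvg_cst].
Qed.

Lemma coercivity_continuous :
  continuous (fun x : R * R * R => coercivity x.1.1 x.1.2 x.2).
Proof.
move=> -[[x1 x2] x3] /=.
have c1 : (fun x : R * R * R => x.1.1) @ (x1, x2, x3) --> x1.
  by apply: (cvg_comp (fun x : R * R * R => x.1) fst); exact: cvg_fst.
have c2 : (fun x : R * R * R => x.1.2) @ (x1, x2, x3) --> x2.
  by apply: (cvg_comp (fun x : R * R * R => x.1) snd); [exact: cvg_fst|exact: cvg_snd].
have c3 : (fun x : R * R * R => x.2) @ (x1, x2, x3) --> x3 by exact: cvg_snd.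
have cs (I : R) (f g : R * R * R -> R) (a b : R) : 0 <= I -> f @ (x1, x2, x3) --> a -> g @ (x1, x2, x3) --> b ->
    (fun x : R * R * R => share I (f x) (g x)) @ (x1, x2, x3) --> share I a b.
  move=> I0 fa gb; apply: cvgM; last first.
    by apply: cvgV; [rewrite gt_eqF// sqlen_gt0|exact: cvg_sqlen].
  have Ef : (fun z => expR (f z)) @ (x1, x2, x3) --> expR a.
    by apply: (cvg_comp f expR fa); exact: continuous_expR.
  have Eg : (fun z => expR (g z)) @ (x1, x2, x3) --> expR b.
    by apply: (cvg_comp g expR gb); exact: continuous_expR.
  apply: cvgD; first by rewrite !expr2; apply: cvgM.
  by apply: cvgM; [apply: cvgM|exact: cvg_cst].
apply: cvgM.
  apply: cvgM; first by apply: cvg_sqrt; apply: cvg_heron; exact: cvg_sqlen.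
  by apply: cvgD; (apply: cvgM; [apply: cvgM|]); apply: cs.
apply: cvgV.
  rewrite gt_eqF//; apply: mulr_gt0 => //.
  by apply: addr_gt0; [apply: addr_gt0|]; exact: sqlen_gt0.
apply: cvgM; first exact: cvg_cst.
by apply: cvgD; [apply: cvgD|]; exact: cvg_sqlen.
Qed.

(** Near a nondegenerate triangle the decrease is quadratic by continuity of
    [coercivity].  A displacement of size at most [D] is scaled by a factor [s]
    into that neighbourhood, and the remaining part of the segment can only
    decrease the pairing further, so the estimate persists with a constant
    smaller by the factor [s]. *)
Lemma tri_energy_coercive x1 x2 x3 D : 0 < tri_heron x1 x2 x3 -> 0 <= D ->
  exists2 c, 0 < c & forall w1 w2 w3,
    `|w1| <= D -> `|w2| <= D -> `|w3| <= D ->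
    tri_energy w1 w2 w3 (x1 + w1) (x2 + w2) (x3 + w3) <=
    tri_energy w1 w2 w3 x1 x2 x3 -
    c * ((w1 - w2) ^+ 2 + (w2 - w3) ^+ 2 + (w1 - w3) ^+ 2).
Proof.
rewrite -coercivity_gt0 => h D0.
set k := coercivity x1 x2 x3 in h.
have k2 : k / 2 < k by rewrite ltr_pdivrMr// ltr_pMr// ltrDl.
have N : nbhs (x1, x2, x3)
    [set x : R * R * R | k / 2 < coercivity x.1.1 x.1.2 x.2].
  exact: (cvgr_gt _ (@coercivity_continuous (x1, x2, x3)) _ k2).
have [e /= e0 He] := (@nbhs_ballP R (R * R * R)%type _ _).1 N.
(* The summand 1 makes s < 1, so that the rest of the segment is not reduced
   to a point. *)
pose s := e / 2 / (D + e / 2 + 1).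
have De : 0 < D + e / 2 + 1 by rewrite ltr_wpDl// addr_ge0// divr_ge0// ltW.
have s0 : 0 < s by rewrite !divr_gt0.
have s1 : s < 1 by rewrite ltr_pdivrMr// mul1r; lra.
exists (k / 2 * s); first by rewrite mulr_gt0// divr_gt0.
move=> w1 w2 w3 hw1 hw2 hw3.
have sw (w : R) : `|w| <= D -> `|s * w| < e.
  move=> hw; rewrite normrM (gtr0_norm s0) (@le_lt_trans _ _ (e / 2))//; last first.
    by rewrite ltr_pdivrMr// ltr_pMr// ltrDl.
  rewrite /s mulrAC ler_pdivrMr// ler_wpM2l// ?divr_ge0 ?(ltW e0)//.
  by rewrite (le_trans hw)//; lra.
have tw (x w t : R) : 0 <= t <= 1 -> `|w| <= D -> ball x e (x + t * (s * w)).
  move=> /andP[t0 t1] hw; rewrite /ball /= opprD addrA subrr sub0r normrN normrM.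
  rewrite (ger0_norm t0) (le_lt_trans _ (sw w hw))//.
  by rewrite ler_piMl.
have loc : tri_energy (s * w1) (s * w2) (s * w3) (x1 + s * w1) (x2 + s * w2)
    (x3 + s * w3) <= tri_energy (s * w1) (s * w2) (s * w3) x1 x2 x3 -
    k / 2 * ((s * w1 - s * w2) ^+ 2 + (s * w2 - s * w3) ^+ 2 +
             (s * w1 - s * w3) ^+ 2).
  apply: tri_energy_decr; last by rewrite divr_gt0.
  move=> t ht; apply: ltW.
  apply: (He (x1 + t * (s * w1), x2 + t * (s * w2), x3 + t * (s * w3))).
  by split; [split|]; exact: tw.
have := tri_energy_nincr (x1 + s * w1) (x2 + s * w2) (x3 + s * w3)
  ((1 - s) * w1) ((1 - s) * w2) ((1 - s) * w3).
have E (x w : R) : x + s * w + (1 - s) * w = x + w by ring.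
rewrite !E.
(* Both estimates concern multiples of w; by linearity they can be divided by
   s and by 1 - s. *)
have lin (a y1 y2 y3 : R) : tri_energy (a * w1) (a * w2) (a * w3) y1 y2 y3 =
    a * tri_energy w1 w2 w3 y1 y2 y3 by rewrite /tri_energy; ring.
rewrite !lin ler_pM2l ?subr_gt0// => far; apply: le_trans far _.
rewrite -(ler_pM2l s0) -lin (le_trans loc)// lin.
by rewrite le_eqVlt; apply/orP; left; apply/eqP; ring.
Qed.

End Triangle.

(** * Counting faces and the discrete Poincare inequality *)

Section Combinatorics.
Context {R : realType} {N : nat} (T : triangulation N).
Implicit Types (G : 'I_N -> 'I_N -> 'I_N -> R) (w : 'I_N -> R).

(** Every face is counted six times, once for each ordering of its vertices;
    this makes the sum invariant under permutations of the arguments and avoids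
    choosing an ordering of each face. *)
Definition triple_sum G : R :=
  \sum_i \sum_j \sum_(k | [set i; j; k]%SET \in faces T) G i j k.

Lemma set3_rot (i j k : 'I_N) : [set j; k; i]%SET = [set i; j; k]%SET.
Proof. by rewrite finset.setUC finset.setUA. Qed.

Lemma set3_swap (i j k : 'I_N) : [set i; k; j]%SET = [set i; j; k]%SET.
Proof. by rewrite -!finset.setUA (finset.setUC [set k]%SET). Qed.

Lemma eq_triple_sum G G' :
  (forall i j k, [set i; j; k]%SET \in faces T -> G i j k = G' i j k) ->
  triple_sum G = triple_sum G'.
Proof.
by move=> H; apply: eq_bigr => i _; apply: eq_bigr => j _; apply: eq_bigr => k /H.
Qed.

Lemma ler_triple_sum G G' :
  (forall i j k, [set i; j; k]%SET \in faces T -> G i j k <= G' i j k) ->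
  triple_sum G <= triple_sum G'.
Proof.
by move=> H; apply: ler_sum => i _; apply: ler_sum => j _; apply: ler_sum => k /H.
Qed.

Lemma triple_sumD G G' :
  triple_sum (fun i j k => G i j k + G' i j k) = triple_sum G + triple_sum G'.
Proof.
rewrite -big_split; apply: eq_bigr => i _; rewrite -big_split.
by apply: eq_bigr => j _; rewrite -big_split.
Qed.

Lemma triple_sumZ a G :
  triple_sum (fun i j k => a * G i j k) = a * triple_sum G.
Proof.
rewrite mulr_sumr; apply: eq_bigr => i _; rewrite mulr_sumr.
by apply: eq_bigr => j _; rewrite mulr_sumr.
Qed.

Lemma triple_sum_rot G :
  triple_sum (fun i j k => G j k i) = triple_sum G.
Proof.
rewrite /triple_sum exchange_big; apply: eq_bigr => j _.
under eq_bigr do rewrite big_mkcond.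
rewrite exchange_big; apply: eq_bigr => k _; rewrite [RHS]big_mkcond.
by apply: eq_bigr => i _; rewrite (set3_rot i j k).
Qed.

Lemma triple_sum_cycle G : 3 * triple_sum G =
  triple_sum (fun i j k => G i j k + G j k i + G k i j).
Proof.
have h1 := triple_sum_rot G; have h2 := triple_sum_rot (fun i j k => G j k i).
by rewrite 2!triple_sumD h2 h1; ring.
Qed.

Lemma face_distinct i j k : [set i; j; k]%SET \in faces T ->
  [/\ i != j, j != k & i != k].
Proof.
move=> /face_card c3; split; apply/eqP => E; move: c3; rewrite E.
- by rewrite finset.setUid cards2; case: (_ == _).
- by rewrite -finset.setUA finset.setUid cards2; case: (_ == _).
- by rewrite finset.setUC finset.setUA finset.setUid cards2; case: (_ == _).
Qed.

Lemma triple_sum_half G : (forall i j k, G i k j = G i j k) ->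
  \sum_(i < N) \sum_(j < N) \sum_(k < N | (j < k)%N && ([set i; j; k]%SET \in faces T))
    G i j k = triple_sum G / 2.
Proof.
move=> GC; rewrite mulr_suml; apply: eq_bigr => i _.
set L := (LHS); suff <- : L + L = \sum_(j < N)
    \sum_(k < N | [set i; j; k]%SET \in faces T) G i j k.
  by clearbody L; lra.
rewrite {2}/L [X in _ + X](_ : _ = \sum_(j < N) \sum_(k < N | (k < j)%N &&
   ([set i; j; k]%SET \in faces T)) G i j k); last first.
  under eq_bigr do rewrite big_mkcond; rewrite exchange_big; apply: eq_bigr => k _.
  by rewrite [RHS]big_mkcond; apply: eq_bigr => j _; rewrite set3_swap GC.
rewrite -big_split; apply: eq_bigr => j _ /=.
rewrite [RHS](bigID (fun k : 'I_N => (j < k)%N)) /=; congr (_ + _).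
  by apply: eq_bigl => k; rewrite andbC.
apply: eq_bigl => k.
case hf : ([set i; j; k]%SET \in faces T); rewrite ?andbF //= andbT.
rewrite -leqNgt ltn_neqAle; have [_ jk _] := face_distinct hf.
by rewrite eq_sym jk.
Qed.

Lemma set3_eqE (f : {set 'I_N}) i j k : #|f| = 3 ->
  ([set i; j; k]%SET == f) = [&& i \in f, j \in f :\ i & k \in f :\ i :\ j]%SET.
Proof.
move=> f3; apply/eqP/and3P.
  move=> E; move: f3; rewrite -E.
  have [->|ij] := eqVneq i j; first by rewrite finset.setUid cards2; case: (_ == _).
  have [->|jk] := eqVneq j k.
    by rewrite -finset.setUA finset.setUid cards2; case: (_ == _).
  have [->|ik] := eqVneq i k.
    by rewrite finset.setUC finset.setUA finset.setUid cards2; case: (_ == _).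
  by rewrite !inE !eqxx !orbT (eq_sym k) (eq_sym j) (eq_sym k) ij jk ik.
rewrite !inE => -[fi /andP[ji fj] /and3P[kj ki fk]].
apply/eqP; rewrite eqEcard f3; apply/andP; split.
  by rewrite !finset.subUset !finset.sub1set fi fj fk.
by rewrite finset.setUC cardsU1 cards2 !inE negb_or ki kj (eq_sym i) ji.
Qed.

Lemma triple_sum_const a : triple_sum (fun _ _ _ => a) = 6 * #|faces T|%:R * a.
Proof.
have -> : triple_sum (fun _ _ _ => a) =
    \sum_(f in faces T) \sum_i \sum_j \sum_(k | [set i; j; k]%SET == f) a.
  rewrite /triple_sum [RHS]exchange_big; apply: eq_bigr => i _.
  rewrite [RHS]exchange_big; apply: eq_bigr => j _.
  under [RHS]eq_bigr do rewrite big_mkcond.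
  rewrite [RHS]exchange_big big_mkcond; apply: eq_bigr => k _.
  case: ifP => h; last first.
    by rewrite big1// => f ff; case: eqP => // E; rewrite E ff in h.
  rewrite (bigD1 [set i; j; k]%SET) //= eqxx big1 ?addr0// => f /andP[_ /negbTE].
  by rewrite eq_sym => ->.
rewrite (eq_bigr (fun=> 6 * a)) => [|f /face_card f3].
  by rewrite sumr_const -mulr_natr; ring.
have -> : \sum_i \sum_j \sum_(k | [set i; j; k]%SET == f) a =
    \sum_(i in f) \sum_(j in (f :\ i)%SET) \sum_(k in (f :\ i :\ j)%SET) a.
  rewrite [RHS]big_mkcond; apply: eq_bigr => i _; case: ifP => fi; last first.
    rewrite big1// => j _; rewrite big_pred0// => k.
    by rewrite set3_eqE// fi.
  rewrite [RHS]big_mkcond; apply: eq_bigr => j _; case: ifP => fj; last first.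
    by rewrite big_pred0// => k; rewrite set3_eqE// fj andbF.
  by apply: eq_bigl => k; rewrite set3_eqE// fi fj.
rewrite (eq_bigr (fun=> 2 * a)) => [|i fi].
  by rewrite sumr_const f3 -mulr_natr; ring.
have c2 : #|(f :\ i)%SET| = 2.
  by have := cardsD1 i f; rewrite fi f3 add1n => -[].
rewrite (eq_bigr (fun=> a)) => [|j fj].
  by rewrite sumr_const c2 -mulr_natr; ring.
have c1 : #|(f :\ i :\ j)%SET| = 1.
  by have := cardsD1 j (f :\ i)%SET; rewrite fj c2 add1n => -[].
by rewrite sumr_const c1 mulr1n.
Qed.

(** Double counting of the pairs of an edge and a face containing it. *)
Lemma faces_edges : (3 * #|faces T| = 2 * #|edges T|)%N.
Proof.
have -> : (3 * #|faces T| = \sum_(f in faces T) \sum_(e in edges T | e \subset f) 1)%N.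
  rewrite -sum1_card big_distrr /=; apply: eq_bigr => f ff.
  have f3 := face_card ff.
  have -> : (3 * 1 = 'C(#|f|, 2))%N by rewrite f3.
  rewrite -cards_draws -sum1_card; apply: eq_bigl => e; rewrite inE.
  apply/andP/andP => [[ef /eqP e2]|[/edgeP[e2 _] ef]]; split=> //.
    by apply/edgeP; split=> //; exists f.
  by rewrite e2.
rewrite -sum1_card big_distrr /= (exchange_big_dep (mem (edges T))) /=; last first.
  by move=> f e _ /andP[].
apply: eq_bigr => e he.
transitivity #|[set f in faces T | e \subset f]|%SET; last first.
  by rewrite (edge_in_two_faces he).
rewrite -sum1_card.
by apply: eq_bigl => f; rewrite inE he.
Qed.

Lemma euler_charE : (euler_char T)%:~R = N%:R - #|faces T|%:R / 2 :> R.
Proof.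
rewrite /euler_char intrD intrB -!pmulrn.
have : (3 * #|faces T|)%:R = (2 * #|edges T|)%:R :> R by rewrite faces_edges.
by rewrite !natrM => H; lra.
Qed.

Definition dirichlet w : R := triple_sum (fun i j k =>
  (w i - w j) ^+ 2 + (w j - w k) ^+ 2 + (w i - w k) ^+ 2).

Lemma dirichlet_ge0 w : 0 <= dirichlet w.
Proof.
by do 3 (apply: sumr_ge0 => ? _); rewrite !addr_ge0 ?sqr_ge0.
Qed.

Lemma edge_third a b : [set a; b]%SET \in edges T ->
  exists k, [set a; b; k]%SET \in faces T.
Proof.
move=> /edgeP[e2 [f ff ef]]; have f3 := face_card ff.
have /set0Pn[k] : (f :\: [set a; b])%SET != finset.set0.
  rewrite -card_gt0 cardsD; have /finset.setIidPr -> := ef.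
  by rewrite f3 e2.
rewrite inE => /andP[kab fk]; exists k.
suff -> : [set a; b; k]%SET = f by [].
apply/eqP; rewrite eqEcard f3 finset.setUC cardsU1 kab e2 andbT.
by rewrite finset.subUset finset.sub1set fk.
Qed.

Lemma dirichlet_edge a b w : [set a; b]%SET \in edges T ->
  (w a - w b) ^+ 2 <= dirichlet w.
Proof.
move=> /edge_third[c hc]; rewrite /dirichlet /triple_sum.
have ge0 i j k : 0 <= (w i - w j) ^+ 2 + (w j - w k) ^+ 2 + (w i - w k) ^+ 2.
  by rewrite !addr_ge0 ?sqr_ge0.
rewrite (bigD1 a) //= (bigD1 b) //= (bigD1 c) //=.
rewrite -!addrA; apply: ler_wpDr => //.
by rewrite !addr_ge0 ?sqr_ge0//; apply: sumr_ge0 => ? _ //;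
  apply: sumr_ge0 => ? _ //; apply: sumr_ge0 => ? _ //.
Qed.

(** Chain the edges of a path from [a] to [b]. *)
Lemma dirichlet_pair a b : exists2 C : R, 0 <= C &
  forall w, (w a - w b) ^+ 2 <= C * dirichlet w.
Proof.
have /connectP[p hp ->] := surface_connected T a b.
elim: p a hp => [|c p IH] a /=.
  by exists 0 => // w; rewrite subrr expr0n mul0r.
move=> /andP[ac /IH[C C0 HC]]; exists (2 + 2 * C) => [|w].
  by rewrite addr_ge0// mulr_ge0.
have h1 := dirichlet_edge w ac; have h2 := HC w.
set z := w (last c p) in h2 *.
have : 0 <= (w a - w c - (w c - z)) ^+ 2 by exact: sqr_ge0.
nra.
Qed.

(** For [w] of zero sum, [sum_(i, j) (w i - w j)^2 = 2 N sum_i (w i)^2]. *)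
Lemma poincare : exists2 c : R, 0 < c &
  forall w, \sum_i w i = 0 -> c * \sum_i w i ^+ 2 <= dirichlet w.
Proof.
have /choice[C HC] : forall p : 'I_N * 'I_N, exists C : R, 0 <= C /\
    forall w, (w p.1 - w p.2) ^+ 2 <= C * dirichlet w.
  by move=> [a b]; have [C C0 H] := dirichlet_pair a b; exists C.
pose S := \sum_p C p.
have S0 : 0 <= S by apply: sumr_ge0 => p _; exact: (HC p).1.
have N0 : 0 < N%:R :> R by rewrite ltr0n (vertex_nonempty T).
exists (2 * N%:R / (S + 1)); first by rewrite divr_gt0 ?mulr_gt0// ltr_wpDl.
move=> w w0.
have E : \sum_p (w p.1 - w p.2) ^+ 2 = 2 * N%:R * \sum_i w i ^+ 2.
  rewrite -(pair_bigA _ (fun i j => (w i - w j) ^+ 2)) /=.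
  transitivity (\sum_i (N%:R * w i ^+ 2 + \sum_j w j ^+ 2)).
    apply: eq_bigr => i _.
    transitivity (\sum_j (w i ^+ 2 + (- (2 * w i) * w j + w j ^+ 2))).
      by apply: eq_bigr => j _; ring.
    have z : \sum_j - (2 * w i) * w j = 0 by rewrite -mulr_sumr w0 mulr0.
    by rewrite !big_split /= z add0r sumr_const card_ord mulr_natl.
  have z : \sum_i N%:R * w i ^+ 2 = N%:R * \sum_i w i ^+ 2 by rewrite mulr_sumr.
  by rewrite big_split /= z sumr_const card_ord -[X in _ + X]mulr_natl; ring.
rewrite mulrAC ler_pdivrMr ?ltr_wpDl// -E.
apply: (@le_trans _ _ (S * dirichlet w)).
  by rewrite mulr_suml; apply: ler_sum => p _; exact: (HC p).2.
by rewrite mulrC ler_wpM2l ?dirichlet_ge0// lerDl.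
Qed.

End Combinatorics.

(** * The extended flow in logarithmic coordinates *)

Lemma cvg_fsum {R : realType} {S : Type} (F : set_system S) {FF : Filter F}
    {J : finType} (P : pred J) (f : J -> S -> R) (a : J -> R) :
  (forall j, P j -> f j @ F --> a j) ->
  (fun x => \sum_(j | P j) f j x) @ F --> \sum_(j | P j) a j.
Proof. by move=> H; apply: cvg_big => //; exact: add_continuous. Qed.

Section Softmax.
Context {R : realType} {n : nat}.
Implicit Types (u v : 'I_n -> R).

Lemma expR_mono_mul (a b : R) : 0 <= (expR a - expR b) * (a - b).
Proof.
have [ab|ba] := leP a b.
  by rewrite mulr_le0// subr_le0// ler_expR.
by rewrite mulr_ge0// subr_ge0 ?ler_expR ltW.
Qed.

(** The Gibbs weights [exp (alpha u_i)], normalized, are a monotone function of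
    [alpha u].  Symmetrizing the double sum over [i] and [j] reduces this to
    the monotonicity of the exponential. *)
Lemma gibbs_dissipative (alpha c : R) u v : alpha * c <= 0 ->
  \sum_i (c * expR (alpha * u i) / (\sum_j expR (alpha * u j)) -
          c * expR (alpha * v i) / (\sum_j expR (alpha * v j))) * (u i - v i) <= 0.
Proof.
move=> ac.
case: n u v => [|m] u v; first by rewrite big_ord0.
set SE := \sum_j expR (alpha * u j); set SF := \sum_j expR (alpha * v j).
have S0 (f : 'I_m.+1 -> R) : 0 < \sum_j expR (f j).
  rewrite (bigD1 ord0) //=; apply: ltr_wpDr; last exact: expR_gt0.
  by apply: sumr_ge0 => j _; exact: expR_ge0.
have SE0 : 0 < SE by exact: S0.
have SF0 : 0 < SF by exact: S0.
pose P i j := expR (alpha * u i) * expR (alpha * v j) -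
              expR (alpha * v i) * expR (alpha * u j).
have -> : \sum_i (c * expR (alpha * u i) / SE - c * expR (alpha * v i) / SF) *
    (u i - v i) = c / (SE * SF) * \sum_i \sum_j P i j * (u i - v i).
  rewrite mulr_sumr; apply: eq_bigr => i _.
  rewrite -mulr_suml /P sumrB -!mulr_sumr -/SE -/SF; field.
  by rewrite !gt_eqF.
have -> : \sum_i \sum_j P i j * (u i - v i) =
    2^-1 * \sum_i \sum_j P i j * ((u i - v i) - (u j - v j)).
  have E : \sum_i \sum_j P i j * (u j - v j) = - \sum_i \sum_j P i j * (u i - v i).
    rewrite exchange_big -sumrN; apply: eq_bigr => i _; rewrite -sumrN.
    by apply: eq_bigr => j _; rewrite /P; ring.
  have -> : \sum_i \sum_j P i j * ((u i - v i) - (u j - v j)) =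
      \sum_i \sum_j P i j * (u i - v i) - \sum_i \sum_j P i j * (u j - v j).
    by rewrite -sumrB; apply: eq_bigr => i _; rewrite -sumrB; apply: eq_bigr => j _;
      rewrite mulrBr.
  by rewrite E; field.
have -> : c / (SE * SF) * (2^-1 * \sum_i \sum_j P i j * ((u i - v i) - (u j - v j))) =
    (2 * SE * SF)^-1 * \sum_i \sum_j c * (P i j * ((u i - v i) - (u j - v j))).
  under [in RHS]eq_bigr do rewrite -mulr_sumr.
  by rewrite -mulr_sumr; field; rewrite !gt_eqF.
rewrite pmulr_rle0; last by rewrite invr_gt0 !mulr_gt0.
apply: sumr_le0 => i _; apply: sumr_le0 => j _.
have := expR_mono_mul (alpha * u i + alpha * v j) (alpha * v i + alpha * u j).
rewrite !expRD -/(P i j).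
have -> : alpha * u i + alpha * v j - (alpha * v i + alpha * u j) =
    alpha * (u i - v i - (u j - v j)) by ring.
set z := u i - v i - (u j - v j) => Pz.
have [a0|a0] := eqVneq alpha 0.
  by rewrite /P a0 !mul0r subrr mul0r mulr0.
have -> : c * (P i j * z) = (alpha * c) * (P i j * (alpha * z)) / alpha ^+ 2.
  by field.
rewrite pmulr_lle0; last by rewrite invr_gt0 exprn_even_gt0.
exact: mulr_le0_ge0.
Qed.

End Softmax.

Section FlowField.
Context {R : realType} {N : nat} (T : triangulation N).
Variables (I : {set 'I_N} -> R) (alpha : R).
Hypothesis I_ge0 : forall e, e \in edges T -> 0 <= I e.
Hypothesis alpha_chi : alpha * (euler_char T)%:~R <= 0.
Implicit Types (u v w : 'rV[R]_N).

Definition expv u : 'rV[R]_N := \row_i expR (u 0 i).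

Definition face_angle u (i j k : 'I_N) : R :=
  angle1 (I [set j; k]%SET) (I [set k; i]%SET) (I [set i; j]%SET)
    (u 0 i) (u 0 j) (u 0 k).

(** The velocity of the extended flow at the point of coordinates
    [u i = ln (r i)]. *)
Definition flow_field u (i : 'I_N) : R :=
  s_alpha T alpha (expv u) * expv u 0 i `^ alpha - ext_curvature T I (expv u) i.

Lemma face_edge i j k : [set i; j; k]%SET \in faces T ->
  [set i; j]%SET \in edges T.
Proof.
move=> hf; have [ij _ _] := face_distinct hf; apply/edgeP; split.
  by rewrite cards2 ij.
by exists [set i; j; k]%SET => //; exact: finset.subsetUl.
Qed.

Lemma face_weights i j k : [set i; j; k]%SET \in faces T ->
  [/\ 0 <= I [set j; k]%SET, 0 <= I [set k; i]%SET & 0 <= I [set i; j]%SET].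
Proof.
move=> hf; split; apply: I_ge0.
- by apply: (@face_edge _ _ i); rewrite set3_rot.
- by apply: (@face_edge _ _ j); rewrite -set3_rot.
- exact: face_edge hf.
Qed.

Lemma edge_lengthE u i j : edge_length I (expv u) i j =
  Num.sqrt (sqlen (I [set i; j]%SET) (u 0 i) (u 0 j)).
Proof. by rewrite /edge_length /sqlen !mxE. Qed.

Lemma face_angle_swap u i j k : face_angle u i k j = face_angle u i j k.
Proof.
rewrite /face_angle /angle1 ang_swap (finset.setUC [set k]%SET [set j]%SET).
rewrite (finset.setUC [set j]%SET [set i]%SET) (finset.setUC [set k]%SET [set i]%SET).
by rewrite (sqlenC _ (u 0 k) (u 0 j)) (sqlenC _ (u 0 i) (u 0 k))
  (sqlenC _ (u 0 j) (u 0 i)).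
Qed.

Lemma gen_face_angle u i j k : [set i; j; k]%SET \in faces T ->
  gen_inner_angle (edge_length I (expv u) j k) (edge_length I (expv u) i j)
    (edge_length I (expv u) i k) = face_angle u i j k.
Proof.
move=> /face_weights[h1 h2 h3].
have h2' : 0 <= I [set i; k]%SET by rewrite finset.setUC.
rewrite !edge_lengthE gen_inner_angleE ?sqrtr_gt0 ?sqlen_gt0//.
rewrite !sqr_sqrtr ?(ltW (sqlen_gt0 _ _ _))// ang_swap.
by rewrite /face_angle /angle1 (finset.setUC [set i]%SET [set k]%SET) (sqlenC _ (u 0 i) (u 0 k)).
Qed.

Lemma ext_curvatureE u i : ext_curvature T I (expv u) i =
  2 * pi - \sum_(j < N) \sum_(k < N | (j < k)%N &&
             ([set i; j; k]%SET \in faces T)) face_angle u i j k.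
Proof.
congr (_ - _); apply: eq_bigr => j _; apply: eq_bigr => k /andP[_ hf].
exact: gen_face_angle.
Qed.

Definition face_energy (w : 'I_N -> R) u i j k : R :=
  tri_energy (I [set j; k]%SET) (I [set k; i]%SET) (I [set i; j]%SET)
    (w i) (w j) (w k) (u 0 i) (u 0 j) (u 0 k).

(** The three cyclic orderings of a face gather its three angles into one
    [tri_energy]; the factor 6 is the number of its orderings. *)
Lemma curvature_pairing (w : 'I_N -> R) u :
  \sum_i ext_curvature T I (expv u) i * w i =
  2 * pi * \sum_i w i - triple_sum T (face_energy w u) / 6.
Proof.
under eq_bigr do rewrite ext_curvatureE mulrBl.
rewrite sumrB -mulr_sumr; congr (_ - _).
have -> : triple_sum T (face_energy w u) =
    3 * triple_sum T (fun i j k => face_angle u i j k * w i).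
  rewrite triple_sum_cycle; apply: eq_triple_sum => i j k _.
  rewrite /face_energy /tri_energy /face_angle /angle1 /angle2 /angle3; ring.
transitivity (triple_sum T (fun i j k => face_angle u i j k * w i) / 2).
  rewrite -triple_sum_half => [|i j k]; last by rewrite face_angle_swap.
  apply: eq_bigr => i _; rewrite mulr_suml; apply: eq_bigr => j _.
  by rewrite mulr_suml.
by field.
Qed.

Lemma gauss_bonnet u :
  \sum_i ext_curvature T I (expv u) i = 2 * pi * (euler_char T)%:~R.
Proof.
have := curvature_pairing (fun=> 1) u.
under eq_bigr do rewrite mulr1.
move=> ->; rewrite (@eq_triple_sum _ _ T _ (fun _ _ _ => pi)).
  by rewrite triple_sum_const euler_charE sumr_const card_ord; field.
move=> i j k /face_weights[h1 h2 h3].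
rewrite /face_energy /tri_energy !mul1r /angle1 /angle2 /angle3.
by apply: angle_sum; exact: sqlen_gt0.
Qed.

Lemma powR_expR (x : R) : expR x `^ alpha = expR (alpha * x).
Proof. by rewrite /powR gt_eqF ?expR_gt0// expRK. Qed.

Lemma drift_gibbs u i : s_alpha T alpha (expv u) * expv u 0 i `^ alpha =
  2 * pi * (euler_char T)%:~R * expR (alpha * u 0 i) /
  (\sum_j expR (alpha * u 0 j)).
Proof.
rewrite /s_alpha mxE powR_expR mulrAC; congr (_ / _).
by apply: eq_bigr => j _; rewrite mxE powR_expR.
Qed.

Lemma gibbs_sum_gt0 u : 0 < \sum_j expR (alpha * u 0 j).
Proof.
have i0 : 'I_N := Ordinal (vertex_nonempty T).
rewrite (bigD1 i0) //=; apply: ltr_wpDr; last exact: expR_gt0.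
by apply: sumr_ge0 => j _; exact: expR_ge0.
Qed.

Lemma flow_field_sum u : \sum_i flow_field u i = 0.
Proof.
rewrite sumrB gauss_bonnet; apply/eqP; rewrite subr_eq0; apply/eqP.
under eq_bigr do rewrite drift_gibbs.
by rewrite -mulr_suml -mulr_sumr mulfK// gt_eqF// gibbs_sum_gt0.
Qed.

Lemma ang_itv (p q s : R) : 0 <= ang p q s <= pi.
Proof. by rewrite acos_ge0 ?acos_lepi// clamp_itv. Qed.

Lemma flow_field_bounded : exists2 B : R, 0 <= B &
  forall u i, `|flow_field u i| <= B.
Proof.
pose C := `|2 * pi * (euler_char T)%:~R : R|.
exists (C + (2 * pi + N%:R * (N%:R * pi))).
  have p0 := pi_ge0 R; apply: addr_ge0; first exact: normr_ge0.
  apply: addr_ge0; apply: mulr_ge0 => //.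
  exact: mulr_ge0.
move=> u i; rewrite (le_trans (ler_normB _ _))// lerD//.
  rewrite drift_gibbs -mulrA normrM ler_piMr//.
  have e0 : 0 <= expR (alpha * u 0 i) by exact: expR_ge0.
  rewrite ger0_norm ?divr_ge0 ?(ltW (gibbs_sum_gt0 _))//.
  rewrite ler_pdivrMr ?gibbs_sum_gt0// mul1r (bigD1 i) //= lerDl.
  by apply: sumr_ge0 => j _; exact: expR_ge0.
rewrite ext_curvatureE (le_trans (ler_normB _ _))// lerD//.
  by rewrite ger0_norm// mulr_ge0// pi_ge0.
rewrite (le_trans (ler_norm_sum _ _ _))//.
have -> : N%:R * (N%:R * pi) = \sum_(j < N) \sum_(k < N) pi :> R.
  by rewrite !sumr_const card_ord !mulr_natl.
apply: ler_sum => j _; rewrite (le_trans (ler_norm_sum _ _ _))//.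
rewrite big_mkcond; apply: ler_sum => k _; case: ifP => _; last exact: pi_ge0.
by have /andP[h1 h2] := ang_itv (sqlen (I [set j; k]%SET) (u 0 j) (u 0 k))
  (sqlen (I [set k; i]%SET) (u 0 k) (u 0 i)) (sqlen (I [set i; j]%SET) (u 0 i) (u 0 j));
  rewrite ger0_norm.
Qed.

Lemma cvg_flow_field {S : Type} (F : set_system S) {FF : Filter F}
    (f : S -> 'rV[R]_N) u i :
  (forall j, (fun s => f s 0 j) @ F --> u 0 j) ->
  (fun s => flow_field (f s) i) @ F --> flow_field u i.
Proof.
move=> cu.
have ce j : (fun s => expR (alpha * f s 0 j)) @ F --> expR (alpha * u 0 j).
  have ca : (fun s => alpha * f s 0 j) @ F --> alpha * u 0 j.
    by apply: cvgMl_tmp; exact: cu.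
  by apply: (cvg_comp (fun s => alpha * f s 0 j) expR ca); exact: continuous_expR.
rewrite {2}/flow_field drift_gibbs ext_curvatureE.
rewrite (_ : (fun s => _) = fun s =>
  2 * pi * (euler_char T)%:~R * expR (alpha * f s 0 i) /
  (\sum_j expR (alpha * f s 0 j)) - (2 * pi - \sum_(j < N) \sum_(k < N | (j < k)%N &&
             ([set i; j; k]%SET \in faces T)) face_angle (f s) i j k)); last first.
  by apply/funext => s; rewrite /flow_field drift_gibbs ext_curvatureE.
apply: cvgB.
  apply: cvgM; first by apply: cvgM; [exact: cvg_cst|exact: ce].
  by apply: cvgV; [rewrite gt_eqF// gibbs_sum_gt0|apply: cvg_fsum => j _; exact: ce].
apply: cvgB; first exact: cvg_cst.
apply: cvg_fsum => j _; apply: cvg_fsum => k /andP[_ /face_weights[h1 h2 h3]].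
by apply: cvg_ang; try exact: sqlen_gt0; apply: cvg_sqlen.
Qed.

Lemma flow_field_pairing (w : 'I_N -> R) u v :
  \sum_i (flow_field u i - flow_field v i) * w i =
  \sum_i (2 * pi * (euler_char T)%:~R * expR (alpha * u 0 i) /
     (\sum_j expR (alpha * u 0 j)) - 2 * pi * (euler_char T)%:~R *
     expR (alpha * v 0 i) / (\sum_j expR (alpha * v 0 j))) * w i
  + triple_sum T (fun i j k => face_energy w u i j k - face_energy w v i j k) / 6.
Proof.
have -> : triple_sum T (fun i j k => face_energy w u i j k - face_energy w v i j k) / 6 =
  \sum_i ext_curvature T I (expv v) i * w i - \sum_i ext_curvature T I (expv u) i * w i.
  rewrite !curvature_pairing triple_sumD.
  have -> : triple_sum T (fun i j k => - face_energy w v i j k) =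
     - triple_sum T (face_energy w v).
    rewrite -[RHS]mulN1r -triple_sumZ; apply: eq_triple_sum => i j k _.
    by rewrite mulN1r.
  by field.
rewrite -sumrB -big_split; apply: eq_bigr => i _ /=.
rewrite /flow_field !drift_gibbs; ring.
Qed.

Lemma drift_pairing_le0 u v :
  \sum_i (2 * pi * (euler_char T)%:~R * expR (alpha * u 0 i) /
     (\sum_j expR (alpha * u 0 j)) - 2 * pi * (euler_char T)%:~R *
     expR (alpha * v 0 i) / (\sum_j expR (alpha * v 0 j))) * (u 0 i - v 0 i) <= 0.
Proof.
apply: (@gibbs_dissipative _ _ alpha _ (fun i => u 0 i) (fun i => v 0 i)).
by rewrite mulrCA pmulr_rle0// mulr_gt0// pi_gt0.
Qed.

Lemma flow_field_dissipative u v :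
  \sum_i (flow_field u i - flow_field v i) * (u 0 i - v 0 i) <= 0.
Proof.
rewrite flow_field_pairing -[leRHS]addr0 lerD ?drift_pairing_le0//.
rewrite pmulr_lle0 ?invr_gt0//.
have -> : 0 = triple_sum T (fun _ _ _ => 0 : R) by rewrite triple_sum_const mulr0.
apply: ler_triple_sum => i j k /face_weights[h1 h2 h3].
rewrite subr_le0 /face_energy.
have := tri_energy_nincr h1 h2 h3 (v 0 i) (v 0 j) (v 0 k) (u 0 i - v 0 i)
  (u 0 j - v 0 j) (u 0 k - v 0 k).
by rewrite !(addrC (v _ _)) !subrK.
Qed.

(** Finitely many positive constants have a positive minimum. *)
Lemma uniform_pos (X : finType) (P : X -> R -> Prop) :
  (forall x, exists2 c, 0 < c & forall c', 0 < c' -> c' <= c -> P x c') ->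
  exists2 c, 0 < c & forall x, P x c.
Proof.
move=> H.
have /choice[f Hf] : forall x, exists c, 0 < c /\ forall c', 0 < c' -> c' <= c -> P x c'.
  by move=> x; have [c c0 Hc] := H x; exists c.
pose m := \big[Num.min/1]_x f x.
have m0 : 0 < m by apply/bigmin_gtP; split=> // x _; exact: (Hf x).1.
exists m => // x; apply: (Hf x).2 => //; exact: bigmin_le_cond.
Qed.

Lemma face_triangle_ineqs u i j k : [set i; j; k]%SET \in faces T ->
  triangle_ineqs (edge_length I (expv u) j k) (edge_length I (expv u) i j)
    (edge_length I (expv u) i k) =
  (0 < tri_heron (I [set j; k]%SET) (I [set k; i]%SET) (I [set i; j]%SET)
         (u 0 i) (u 0 j) (u 0 k)).
Proof.
move=> /face_weights[h1 h2 h3].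
have h2' : 0 <= I [set i; k]%SET by rewrite finset.setUC.
rewrite !edge_lengthE triangle_ineqs_heron ?sqrtr_gt0 ?sqlen_gt0//.
rewrite !sqr_sqrtr ?(ltW (sqlen_gt0 _ _ _))// heron_swap.
by rewrite /tri_heron (finset.setUC [set i]%SET [set k]%SET) (sqlenC _ (u 0 i) (u 0 k)).
Qed.

Lemma positive_expv u : positive_vec (expv u).
Proof. by move=> i; rewrite mxE expR_gt0. Qed.

Lemma curvatureE u i : Omega T I (expv u) ->
  curvature T I (expv u) i = ext_curvature T I (expv u) i.
Proof.
move=> [_ H]; congr (_ - _); apply: eq_bigr => j _; apply: eq_bigr => k /andP[_ hf].
by rewrite /gen_inner_angle H.
Qed.

(** Summing over the vertices, Gauss--Bonnet identifies the common value of the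
    alpha-curvature with [s_alpha]. *)
Lemma flow_field_equilibrium u :
  constant_alpha_curvature T I alpha (expv u) -> forall i, flow_field u i = 0.
Proof.
move=> [Ou [c Hc]] i.
have K j : ext_curvature T I (expv u) j = c * expR (alpha * u 0 j).
  rewrite -(Hc j) /alpha_curvature curvatureE// mxE powR_expR divfK//.
  by rewrite gt_eqF// expR_gt0.
have := gauss_bonnet u; under eq_bigr do rewrite K.
rewrite -mulr_sumr => E; rewrite /flow_field drift_gibbs K -E.
by rewrite mulrAC mulfK ?subrr// gt_eqF// gibbs_sum_gt0.
Qed.

Definition shiftv u (a : R) : 'rV[R]_N := \row_i (u 0 i + a).

(** Adding a constant to [u] scales the radii, which leaves all angles
    unchanged; this freedom is used to match the conserved quantity
    [sum_i u i] of the flow. *)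
Lemma constant_curvature_shift u a :
  constant_alpha_curvature T I alpha (expv u) ->
  constant_alpha_curvature T I alpha (expv (shiftv u a)).
Proof.
move=> [Ou [c Hc]].
have O' : Omega T I (expv (shiftv u a)).
  split; first exact: positive_expv.
  move=> i j k hf; rewrite face_triangle_ineqs//.
  have := Ou.2 i j k hf; rewrite face_triangle_ineqs// /tri_heron !mxE !sqlenD.
  rewrite /heron; set q2 := sqlen _ _ _; set q3 := sqlen _ _ _; set q1 := sqlen _ _ _.
  set k2 := expR a ^+ 2 => h.
  have -> : 4 * (k2 * q2) * (k2 * q3) - (k2 * q2 + k2 * q3 - k2 * q1) ^+ 2 =
    k2 ^+ 2 * (4 * q2 * q3 - (q2 + q3 - q1) ^+ 2) by ring.
  by rewrite mulr_gt0// !exprn_gt0// expR_gt0.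
split=> //; exists (c / expR (alpha * a)) => i.
rewrite -(Hc i) /alpha_curvature !curvatureE// !mxE !powR_expR mulrDr expRD invfM mulrA.
congr (_ / _ / _); rewrite !ext_curvatureE; congr (_ - _).
apply: eq_bigr => j _; apply: eq_bigr => k _.
by rewrite /face_angle /angle1 !mxE !sqlenD angZ// expR_gt0.
Qed.

(** Each face contributes through [tri_energy_coercive], with one constant for
    all of the finitely many faces, and connectedness turns the sum over the
    edges into the sum over the vertices. *)
Lemma flow_field_coercive u D : Omega T I (expv u) -> 0 <= D ->
  exists2 c, 0 < c & forall v, (forall i, `|v 0 i - u 0 i| <= D) ->
    \sum_i (v 0 i - u 0 i) = 0 ->
    \sum_i (flow_field v i - flow_field u i) * (v 0 i - u 0 i) <=
    - (c * \sum_i (v 0 i - u 0 i) ^+ 2).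
Proof.
move=> [_ Hu] D0.
have [c c0 Hc] : exists2 c : R, 0 < c & forall p : 'I_N * 'I_N * 'I_N,
    [set p.1.1; p.1.2; p.2]%SET \in faces T -> forall w : 'I_N -> R,
    (forall i, `|w i| <= D) ->
    tri_energy (I [set p.1.2; p.2]%SET) (I [set p.2; p.1.1]%SET)
      (I [set p.1.1; p.1.2]%SET) (w p.1.1) (w p.1.2) (w p.2)
      (u 0 p.1.1 + w p.1.1) (u 0 p.1.2 + w p.1.2) (u 0 p.2 + w p.2) <=
    face_energy w u p.1.1 p.1.2 p.2 - c * ((w p.1.1 - w p.1.2) ^+ 2 +
      (w p.1.2 - w p.2) ^+ 2 + (w p.1.1 - w p.2) ^+ 2).
  apply: uniform_pos => -[[i j] k] /=.
  have [hf|hf] := boolP ([set i; j; k]%SET \in faces T); last first.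
    by exists 1 => // c' _ _ hf'; rewrite hf' in hf.
  have [h1 h2 h3] := face_weights hf.
  have hh : 0 < tri_heron (I [set j; k]%SET) (I [set k; i]%SET) (I [set i; j]%SET)
      (u 0 i) (u 0 j) (u 0 k).
    by have := Hu i j k hf; rewrite face_triangle_ineqs.
  have [c c0 Hc] := tri_energy_coercive h1 h2 h3 hh D0.
  exists c => // c' c'0 c'c _ w wD.
  apply: le_trans (Hc _ _ _ (wD i) (wD j) (wD k)) _.
  by rewrite lerD2l lerN2 ler_wpM2r// !addr_ge0// sqr_ge0.
have [c' c'0 Hc'] := @poincare R N T.
exists (c * c' / 6); first by rewrite divr_gt0// mulr_gt0.
move=> v vD v0; pose w i := v 0 i - u 0 i.
rewrite -/(w _) in v0.
rewrite flow_field_pairing -[leRHS]add0r lerD ?drift_pairing_le0//.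
apply: (@le_trans _ _ (- (c * dirichlet T w) / 6)); last first.
  by have := Hc' w v0; rewrite -(ler_pM2l c0) /w; lra.
rewrite ler_pM2r ?invr_gt0// -mulNr -triple_sumZ.
apply: ler_triple_sum => i j k hf.
have := Hc (i, j, k) hf w vD; rewrite /= /face_energy /w !(addrC (u _ _)) !subrK; lra.
Qed.

End FlowField.

(** * Existence of solutions for bounded continuous fields *)

Section LocalDerivative.
Context {R : realType}.

Lemma is_derive_of_eps (f : R -> R) (t l : R) :
  (forall e, 0 < e -> exists2 d, 0 < d & forall h, `|h| < d ->
     `|f (t + h) - f t - h * l| <= e * `|h|) ->
  is_derive t 1 f l.
Proof.
move=> H.
have C : (fun h : R => h^-1 *: ((f \o shift t) (h *: (1 : R)) - f t)) @ 0^' --> l.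
  apply/cvgrPdist_le => e e0; have [d d0 Hd] := H _ e0.
  near=> h.
  have h0 : h != 0 by near: h; exact: nbhs_dnbhs_neq.
  have hd : `|h| < d by near: h; exact: dnbhs0_lt.
  have := Hd h hd; rewrite -ler_pdivrMr ?normr_gt0//; apply: le_trans.
  rewrite -normfV -normrM -normrN /= /GRing.scale /= mulr1 [h + t]addrC.
  by rewrite le_eqVlt; apply/orP; left; apply/eqP; congr (`| _ |); field.
by apply: DeriveDef; [apply/cvg_ex; exists l|apply: cvg_lim].
Unshelve. all: by end_near.
Qed.

Lemma right_derivative_of_eps (f : R -> R) (l : R) :
  (forall e, 0 < e -> exists2 d, 0 < d & forall h, 0 < h -> h < d ->
     `|f h - f 0 - h * l| <= e * h) ->
  h^-1 * (f h - f 0) @[h --> 0^'+] --> l.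
Proof.
move=> H; apply/cvgrPdist_le => e e0; have [d d0 Hd] := H _ e0.
near=> h.
have h0 : 0 < h by near: h; exact: nbhs_right_gt.
have hd : h < d by near: h; exact: nbhs_right_lt.
have := Hd h h0 hd; rewrite -ler_pdivrMr//; apply: le_trans.
rewrite -[X in _ <= _ / X](gtr0_norm h0) -normfV -normrM -normrN.
by rewrite le_eqVlt; apply/orP; left; apply/eqP; congr (`| _ |); field; rewrite gt_eqF.
Unshelve. all: by end_near.
Qed.

(** Limits along an ultrafilter exist at all times simultaneously, which takes
    the place of the extraction of a convergent subsequence. *)
Lemma ultra_bounded_cvg (U : set_system nat) {UU : UltraFilter U} (f : nat -> R)
    (a b : R) : (forall n, a <= f n <= b) -> exists l : R, f @ U --> l.
Proof.
move=> fab.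
have Uab : (f @ U) `[a, b]%classic.
  rewrite (_ : (f @ U) _ = U setT); first exact: filterT.
  by congr U; apply/seteqP; split=> // m _ /=; rewrite in_itv /= fab.
have [l [_ cl]] := @segment_compact R a b (f @ U) _ Uab; exists l => V Vl.
have [//|UV] := in_ultra_setVsetC (f @^-1` V) UU.
by have [y [/= nVy Vy]] := cl (~` V) V UV Vl.
Qed.

End LocalDerivative.

Section Peano.
Context {R : realType} {n : nat}.
Variables (X : 'rV[R]_n -> 'I_n -> R) (B : R) (x0 : 'rV[R]_n).
Hypothesis B_ge0 : 0 <= B.
Hypothesis X_bounded : forall v i, `|X v i| <= B.
Hypothesis X_continuous : forall (v : 'rV[R]_n) (e : R), 0 < e ->
  exists2 d : R, 0 < d & forall w : 'rV[R]_n, (forall j, `|w 0 j - v 0 j| < d) ->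
    forall i, `|X w i - X v i| <= e.

Fixpoint euler (h : R) (k : nat) : 'rV[R]_n :=
  if k is k'.+1 then euler h k' + h *: \row_i X (euler h k') i else x0.

(** While the velocity stays within [e] of [c], the Euler polygon stays within
    the corresponding cone around the line of slope [c]. *)
Lemma euler_drift (h : R) k d i (c e : R) : 0 <= h ->
  (forall m, (m < d)%N -> `|X (euler h (k + m)) i - c| <= e) ->
  `|euler h (k + d) 0 i - euler h k 0 i - d%:R * h * c| <= d%:R * h * e.
Proof.
move=> h0; elim: d => [|d IH] H.
  by rewrite addn0 !mul0r subr0 subrr normr0.
have {}IH := IH (fun m md => H m (ltnW md)).
have Hd := H d (ltnSn d).
rewrite addnS /= !mxE.
set y := euler h (k + d) in IH Hd *.
have -> : y 0 i + h * X y i - euler h k 0 i - d.+1%:R * h * c =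
  (y 0 i - euler h k 0 i - d%:R * h * c) + h * (X y i - c).
  by rewrite -natr1; ring.
rewrite (le_trans (ler_normD _ _))// normrM (ger0_norm h0).
have -> : d.+1%:R * h * e = d%:R * h * e + h * e by rewrite -natr1; ring.
by rewrite lerD// ler_wpM2l.
Qed.

Lemma euler_lipschitz (h : R) k d i : 0 <= h ->
  `|euler h (k + d) 0 i - euler h k 0 i| <= d%:R * h * B.
Proof.
move=> h0; have := @euler_drift h k d i 0 B h0.
rewrite mulr0 subr0; apply => m _; by rewrite subr0.
Qed.

Let step (m : nat) : R := m.+1%:R^-1.
Let index (m : nat) (t : R) : nat := Num.truncn (t * m.+1%:R).
Let approx m (t : R) := euler (step m) (index m t).

Let step_gt0 m : 0 < step m.
Proof. by rewrite invr_gt0. Qed.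

Let index_itv m (t : R) : 0 <= t ->
  (index m t)%:R * step m <= t < (index m t)%:R * step m + step m.
Proof.
move=> t0; have t0' : 0 <= t * m.+1%:R by rewrite mulr_ge0.
have /andP[h1 h2] := truncn_itv t0'.
apply/andP; split; first by rewrite ler_pdivrMr.
have -> : (index m t)%:R * step m + step m = (index m t).+1%:R / m.+1%:R.
  by rewrite -natr1 mulrDl mul1r.
by rewrite ltr_pdivlMr.
Qed.

Let index_diff m (a b : R) : 0 <= a -> a <= b ->
  exists2 d, index m b = (index m a + d)%N & `|d%:R * step m - (b - a)| <= step m.
Proof.
move=> a0 ab; have b0 := le_trans a0 ab.
exists (index m b - index m a)%N.
  by rewrite subnKC// le_truncn// ler_wpM2r.
have le : (index m a <= index m b)%N by rewrite le_truncn// ler_wpM2r.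
rewrite natrB// mulrBl.
have /andP[h1 h2] := index_itv m a0; have /andP[h3 h4] := index_itv m b0.
by rewrite ler_norml; apply/andP; split; lra.
Qed.

(** The limit, along an ultrafilter, of the Euler approximations of step
    [1 / (m + 1)].  For [s] close to [t] the polygon between the times [s] and
    [t] stays where [X] is within [e] of its value at [x t], since the speed is
    bounded by [B]; so [euler_drift] bounds its deviation from the tangent, and
    the bound passes to the limit. *)
Lemma peano : exists2 x : R -> 'rV[R]_n, x 0 = x0 &
  forall t : R, 0 <= t -> forall e : R, 0 < e -> exists2 d : R, 0 < d &
  forall s : R, 0 <= s -> `|s - t| < d -> forall i,
  `|x s 0 i - x t 0 i - (s - t) * X (x t) i| <= e * `|s - t|.
Proof.
have [U [UU oU]] := ultraFilterLemma (@eventually_filter : ProperFilter \oo).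
have /choice[l Hl] : forall p : R * 'I_n, exists y : R, 0 <= p.1 ->
    (fun m => approx m p.1 0 p.2) @ U --> y.
  move=> [t i] /=.
  have [t0|t0] := leP 0 t; last by exists 0.
  have [|y yP] := @ultra_bounded_cvg R U UU (fun m => approx m t 0 i)
      (x0 0 i - t * B) (x0 0 i + t * B); last by exists y.
  move=> m; have := @euler_lipschitz (step m) 0 (index m t) i (ltW (step_gt0 m)).
  rewrite add0n /= -ler_distl => /le_trans; apply.
  by rewrite ler_wpM2r//; case/andP: (index_itv m t0).
pose x t := \row_i l (t, i) : 'rV[R]_n.
have xlim t i : 0 <= t -> (fun m => approx m t 0 i) @ U --> x t 0 i.
  by move=> t0; rewrite mxE; exact: (Hl (t, i)).
have step0 : step @ U --> 0 by apply: cvg_trans cvg_harmonic => V /oU.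
exists x.
  apply/rowP => i.
  have h0 : (fun m => approx m 0 0 i) @ U --> x 0 0 i by exact: xlim.
  have h1 : (fun m => approx m 0 0 i) @ U --> x0 0 i.
    rewrite (_ : (fun m => _) = fun=> x0 0 i); first exact: cvg_cst.
    by apply/funext => m; rewrite /approx /index mul0r truncn0.
  exact: (cvg_unique _ h0 h1).
move=> t t0 e e0.
have [d d0 Hd] := X_continuous (x t) e0.
have B1 : 0 < B + 1 by rewrite ltr_wpDl.
exists (d / 2 / (B + 1)); first by rewrite !divr_gt0.
move=> s s0 st i.
pose a := Num.min s t; pose b := Num.max s t.
have a0 : 0 <= a by rewrite le_min s0 t0.
have ab : a <= b by rewrite ge_min !le_max lexx.
have b0 := le_trans a0 ab.
have abE : `|s - t| = b - a.
  rewrite /a /b; case: leP => h; first by rewrite distrC ger0_norm// subr_ge0.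
  by rewrite gtr0_norm// subr_gt0.
have xabE : `|x s 0 i - x t 0 i - (s - t) * X (x t) i| =
    `|x b 0 i - x a 0 i - (b - a) * X (x t) i|.
  rewrite /a /b; case: leP => h //.
  by rewrite -normrN; congr (`| _ |); ring.
rewrite xabE abE.
set c := X (x t) i.
have L : (fun m => `|approx m b 0 i - approx m a 0 i - (b - a) * c|) @ U -->
    `|x b 0 i - x a 0 i - (b - a) * c|.
  apply: cvg_norm; apply: cvgB; last exact: cvg_cst.
  by apply: cvgB; exact: xlim.
have Rt : (fun m => (b - a + step m) * e + step m * B) @ U --> (b - a + 0) * e + 0 * B.
  apply: cvgD; apply: cvgM; try exact: cvg_cst; last exact: step0.
  by apply: cvgD; [exact: cvg_cst|exact: step0].
have -> : e * (b - a) = (b - a + 0) * e + 0 * B by ring.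
apply: (ler_cvg_to L Rt).
(* At most 3/4 of d is spent by the motion of the polygon between the times a
   and b, and 1/4 by its distance to the limit at time t. *)
have d4 : 0 < d / 4 by rewrite divr_gt0.
have near_t : \forall m \near U, forall j, `|approx m t 0 j - x t 0 j| < d / 4.
  apply: filter_forall => j.
  have /cvgrPdist_lt/(_ _ d4) N := @xlim t j t0.
  near=> m; rewrite distrC; near: m; exact: N.
have sm : 0 < d / 4 / (B + 1) by rewrite divr_gt0.
have near_step : \forall m \near U, step m < d / 4 / (B + 1).
  exact: (cvgr_lt _ step0 _ sm).
near=> m.
have ht : forall j, `|approx m t 0 j - x t 0 j| < d / 4 by near: m; exact: near_t.
have hs : step m < d / 4 / (B + 1) by near: m; exact: near_step.
have sg := step_gt0 m.
have [D DE Dle] := index_diff m a0 ab.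
have [p pE ple] : exists2 p : nat, (p <= D)%N & index m t = (index m a + p)%N.
  have [p pE _] := @index_diff m a t a0 ltac:(by rewrite /a ge_min lexx orbT).
  exists p => //; rewrite -(leq_add2l (index m a)) -pE -DE.
  by rewrite le_truncn// ler_wpM2r// le_max lexx orbT.
have Dh : D%:R * step m <= b - a + step m.
  by move: Dle; rewrite ler_norml => /andP[_]; lra.
have Bd : (b - a + step m) * B < d * 3 / 4.
  have : b - a + step m < d * 3 / 4 / (B + 1).
    have -> : d * 3 / 4 / (B + 1) = d / 2 / (B + 1) + d / 4 / (B + 1).
      by field; rewrite gt_eqF.
    by rewrite ltrD// -abE.
  rewrite ltr_pdivlMr// mulrDr mulr1; apply: le_lt_trans.
  by rewrite lerDl addr_ge0 ?subr_ge0// ltW.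
have drift : forall q, (q < D)%N ->
    `|X (euler (step m) (index m a + q)) i - c| <= e.
  move=> q qD; apply: Hd => j.
  have lip : `|euler (step m) (index m a + q) 0 j - approx m t 0 j| <=
      D%:R * step m * B.
    have wk (r : nat) : (r <= D)%N -> r%:R * step m * B <= D%:R * step m * B.
      by move=> rD; rewrite ler_wpM2r// ler_wpM2r ?(ltW sg)// ler_nat.
    rewrite /approx ple; have [qp|/ltnW pq] := leqP q p.
      rewrite distrC -(subnKC qp) addnA (le_trans (euler_lipschitz _ _ _ (ltW sg)))//.
      by apply: wk; rewrite (leq_trans (leq_subr _ _)).
    rewrite -(subnKC pq) addnA (le_trans (euler_lipschitz _ _ _ (ltW sg)))//.
    by apply: wk; rewrite (leq_trans (leq_subr _ _))// ltnW.
  rewrite -(subrK (approx m t 0 j) (euler _ _ _ _)) -addrA.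
  rewrite (le_lt_trans (ler_normD _ _))//.
  have hj := ht j.
  have : D%:R * step m * B <= (b - a + step m) * B by rewrite ler_wpM2r.
  by lra.
have := euler_drift (ltW sg) drift; rewrite -DE -/(approx m b) -/(approx m a).
set z := approx m b 0 i - approx m a 0 i => zle.
have -> : z - (b - a) * c = (z - D%:R * step m * c) + (D%:R * step m - (b - a)) * c.
  by ring.
rewrite (le_trans (ler_normD _ _))// lerD//.
  by rewrite (le_trans zle)// ler_wpM2r// ltW.
by rewrite normrM ler_pM// X_bounded.
Unshelve. all: by end_near.
Qed.

End Peano.

(** * Dissipative flows *)

Section AbstractFlow.
Context {R : realType} {n : nat}.
Variable X : 'rV[R]_n -> 'I_n -> R.

(** The notion of solution of [u' = X u] on [[0, b)], with a one-sided
    derivative at 0, that corresponds to [log_flow_solution]. *)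
Definition solves (b : \bar R) (u : R -> 'rV[R]_n) : Prop :=
  (forall (t : R) i, 0 < t -> (t%:E < b)%E ->
     is_derive t 1 (fun s => u s 0 i) (X (u t) i)) /\
  (forall i, h^-1 * (u h 0 i - u 0 0 i) @[h --> 0^'+] --> X (u 0) i).

Lemma cvg_of_right_derivative (f : R -> R) (l : R) :
  h^-1 * (f h - f 0) @[h --> 0^'+] --> l -> f @ 0^'+ --> f 0.
Proof.
move=> H.
have L : h * (h^-1 * (f h - f 0)) + f 0 @[h --> 0^'+] --> 0 * l + f 0.
  apply: cvgD; last exact: cvg_cst.
  by apply: cvgM => //; apply: cvg_at_right_filter; exact: cvg_id.
rewrite mul0r add0r in L; apply: cvg_trans L; apply: near_eq_cvg.
near=> h.
have h0 : 0 < h by near: h; exact: nbhs_right_gt.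
by rewrite mulrA divff ?mul1r ?subrK// gt_eqF.
Unshelve. all: by end_near.
Qed.

Lemma nincr_from0 (f df : R -> R) (b : \bar R) :
  (forall t, 0 < t -> (t%:E < b)%E -> is_derive t 1 f (df t) /\ df t <= 0) ->
  f @ 0^'+ --> f 0 -> forall t, 0 <= t -> (t%:E < b)%E -> f t <= f 0.
Proof.
move=> H f0 t; rewrite le_eqVlt => /predU1P[<-//|t0] tb.
have sb s : s <= t -> (s%:E < b)%E by move=> st; apply: le_lt_trans tb; rewrite lee_fin.
apply: (@derive_le0_nincr R f df 0 t) => //; first exact: ltW.
  by move=> x /andP[x0 xt]; apply: H => //; apply: sb; exact: ltW.
apply/(continuous_within_itvP _ t0); split=> //.
  move=> x; rewrite in_itv /= => /andP[x0 xt].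
  by have [d _] := H x x0 (sb _ (ltW xt)); exact: is_derive_cont d.
by apply: cvg_at_left_filter; have [d _] := H t t0 tb; exact: is_derive_cont d.
Qed.

Definition sqdist (u v : 'rV[R]_n) : R := \sum_i (u 0 i - v 0 i) ^+ 2.

Lemma sqdist_ge0 u v : 0 <= sqdist u v.
Proof. by apply: sumr_ge0 => i _; exact: sqr_ge0. Qed.

Lemma is_derive_sqdist (u v : R -> 'rV[R]_n) (du dv : 'I_n -> R) (t : R) :
  (forall i, is_derive t 1 (fun s => u s 0 i) (du i)) ->
  (forall i, is_derive t 1 (fun s => v s 0 i) (dv i)) ->
  is_derive t 1 (fun s => sqdist (u s) (v s))
    (2 * \sum_i (du i - dv i) * (u t 0 i - v t 0 i)).
Proof.
move=> Hu Hv; rewrite mulr_sumr; apply: is_derive_fsum => i.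
have D := is_derive_fB (Hu i) (Hv i).
have DD := is_derive_fM D D.
by apply: is_derive_eq DD _; ring.
Qed.

Lemma cvg_sqdist (F : set_system R) {FF : Filter F} (u v : R -> 'rV[R]_n)
    (a b : 'rV[R]_n) :
  (forall i, (fun s => u s 0 i) @ F --> a 0 i) ->
  (forall i, (fun s => v s 0 i) @ F --> b 0 i) ->
  (fun s => sqdist (u s) (v s)) @ F --> sqdist a b.
Proof.
move=> Hu Hv; apply: cvg_big => [|i _]; first exact: add_continuous.
by rewrite expr2; apply: cvgM; apply: cvgB.
Qed.

Lemma solves_right_cvg b u i : solves b u -> (fun s => u s 0 i) @ 0^'+ --> u 0 0 i.
Proof. by move=> [_ H]; exact: (cvg_of_right_derivative (H i)). Qed.

Lemma solves_constant b w : (forall i, X w i = 0) -> solves b (fun=> w).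
Proof.
move=> Xw; split=> [t i _ _|i]; first by rewrite Xw; exact: is_derive_const.
rewrite Xw (_ : (fun h => _) = fun=> 0); first exact: cvg_cst.
by apply/funext => h; rewrite subrr mulr0.
Qed.

Hypothesis X_dissipative : forall u v,
  \sum_i (X u i - X v i) * (u 0 i - v 0 i) <= 0.
Hypothesis X_sum : forall u, \sum_i X u i = 0.

(** The derivative of the squared distance is twice the pairing of
    [X u - X v] with [u - v]. *)
Lemma flow_contraction b u v : solves b u -> solves b v ->
  forall t, 0 <= t -> (t%:E < b)%E -> sqdist (u t) (v t) <= sqdist (u 0) (v 0).
Proof.
move=> Su Sv; apply: (@nincr_from0 (fun s => sqdist (u s) (v s))
  (fun t => 2 * \sum_i (X (u t) i - X (v t) i) * (u t 0 i - v t 0 i))).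
  move=> t t0 tb; split; last by rewrite pmulr_rle0.
  by apply: is_derive_sqdist => i; [exact: Su.1|exact: Sv.1].
by apply: cvg_sqdist => i; [exact: solves_right_cvg Su|exact: solves_right_cvg Sv].
Qed.

Lemma flow_unique b u v : solves b u -> solves b v -> u 0 = v 0 ->
  forall t, 0 <= t -> (t%:E < b)%E -> u t = v t.
Proof.
move=> Su Sv E t t0 tb; have := flow_contraction Su Sv t0 tb.
have -> : sqdist (u 0) (v 0) = 0.
  by rewrite E; apply: big1 => i _; rewrite subrr expr0n.
move=> le0; have /eqP : sqdist (u t) (v t) = 0.
  by apply/eqP; rewrite eq_le le0 sqdist_ge0.
rewrite psumr_eq0 => [/allP H|i _]; last exact: sqr_ge0.
apply/rowP => i; have := H i (mem_index_enum _).
by rewrite /= sqrf_eq0 subr_eq0 => /eqP.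
Qed.

Lemma flow_sum_constant b u : solves b u ->
  forall t, 0 <= t -> (t%:E < b)%E -> \sum_i u t 0 i = \sum_i u 0 0 i.
Proof.
move=> Su t t0 tb.
have D s : 0 < s -> (s%:E < b)%E -> is_derive s 1 (fun s => \sum_i u s 0 i) 0.
  move=> s0 sb; apply: is_derive_eq (X_sum (u s)).
  by apply: (is_derive_fsum (h := fun i s => u s 0 i)) => i; exact: Su.1.
have C : (fun s => \sum_i u s 0 i) @ 0^'+ --> \sum_i u 0 0 i.
  apply: cvg_big => [|i _]; first exact: add_continuous.
  exact: solves_right_cvg Su.
apply/eqP; rewrite eq_le; apply/andP; split.
  by apply: (nincr_from0 (df := fun=> 0) _ C t0 tb) => s s0 sb; split=> //; exact: D.
rewrite -lerN2.
apply: (@nincr_from0 (fun s => - \sum_i u s 0 i) (fun=> 0) b _ _ t t0 tb).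
  move=> s s0 sb; split=> //; rewrite -[X in is_derive _ _ _ X]oppr0.
  by apply: is_deriveN; exact: D.
by apply: cvgN.
Qed.

(** The contraction keeps [u t] in the ball where the coercivity estimate
    holds, so the product of the squared distance and [exp (2 c t)]
    decreases. *)
Lemma flow_exponential u w (c : R) : solves +oo%E u -> (forall i, X w i = 0) ->
  \sum_i w 0 i = \sum_i u 0 0 i ->
  (forall v, sqdist v w <= sqdist (u 0) w -> \sum_i (v 0 i - w 0 i) = 0 ->
     \sum_i (X v i - X w i) * (v 0 i - w 0 i) <= - (c * sqdist v w)) ->
  forall t, 0 <= t -> sqdist (u t) w <= sqdist (u 0) w * expR (- (2 * c * t)).
Proof.
move=> Su Xw w_sum coer t t0.
have Sw := solves_constant +oo%E Xw.
pose f s := sqdist (u s) w * expR (2 * c * s).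
suff : f t <= f 0.
  by rewrite /f mulr0 expR0 mulr1 expRN ler_pdivlMr// expR_gt0.
pose df s := sqdist (u s) w * (2 * c * expR (2 * c * s)) +
  2 * (\sum_i (X (u s) i - X w i) * (u s 0 i - w 0 i)) * expR (2 * c * s).
have Dexp (s : R) : is_derive s 1 (fun s => expR (2 * c * s)) (2 * c * expR (2 * c * s)).
  have L := is_derive_fM (is_derive_const (2 * c) s) (is_derive_id s 1).
  have E := @is_derive_comp _ _ (fun s => 2 * c * s) s _ _ (is_derive_expR _) L.
  by apply: is_derive_eq E _; rewrite mulr1 mul0r addr0 mulrC.
apply: (@nincr_from0 f df +oo%E) => //; last 2 first.
- apply: cvgM.
    apply: cvg_sqdist => i; [exact: solves_right_cvg Su|exact: solves_right_cvg Sw].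
  apply: cvg_at_right_filter.
  exact: (is_derive_cont (Dexp 0)).
- exact: ltry.
move=> s s0 sb; split.
  have Ds : is_derive s 1 (fun s => sqdist (u s) w)
      (2 * \sum_i (X (u s) i - X w i) * (u s 0 i - w 0 i)).
    by apply: (is_derive_sqdist (v := fun=> w)) => i; [exact: Su.1|exact: Sw.1].
  exact: (is_derive_fM Ds (Dexp s)).
have near_w : sqdist (u s) w <= sqdist (u 0) w.
  exact: (flow_contraction Su Sw (ltW s0) sb).
have sum0 : \sum_i (u s 0 i - w 0 i) = 0.
  by rewrite sumrB (flow_sum_constant Su (ltW s0) sb) w_sum subrr.
have := coer (u s) near_w sum0; rewrite /df.
set P := \sum_i _ => HP; set E := expR _; set Q := sqdist _ _ in HP *.
have -> : Q * (2 * c * E) + 2 * P * E = 2 * E * (c * Q + P) by ring.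
by rewrite pmulr_rle0 ?mulr_gt0 ?expR_gt0//; lra.
Qed.

End AbstractFlow.

Lemma flow_exists {R : realType} {n : nat} (X : 'rV[R]_n -> 'I_n -> R) (B : R) (x0 : 'rV[R]_n) :
  0 <= B -> (forall v i, `|X v i| <= B) ->
  (forall (v : 'rV[R]_n) (e : R), 0 < e ->
    exists2 d : R, 0 < d & forall w : 'rV[R]_n, (forall j, `|w 0 j - v 0 j| < d) ->
    forall i, `|X w i - X v i| <= e) ->
  exists2 u, u 0 = x0 & solves X +oo%E u.
Proof.
move=> B0 XB Xc; have [u u0 Hu] := peano x0 B0 XB Xc.
exists u => //; split=> [t i t0 _|i].
  apply: is_derive_of_eps => e e0; have [d d0 Hd] := Hu t (ltW t0) e e0.
  exists (Num.min d t); first by rewrite lt_min d0.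
  move=> h; rewrite lt_min => /andP[hd ht].
  have th : 0 <= t + h.
    by have := ler_norm (- h); rewrite normrN; lra.
  have := Hd (t + h) th; rewrite [t + h]addrC addrK => /(_ hd i).
  by [].
apply: right_derivative_of_eps => e e0; have [d d0 Hd] := Hu 0 (lexx 0) e e0.
exists d => // h h0 hd; have := Hd h (ltW h0).
by rewrite subr0 gtr0_norm// => /(_ hd i).
Qed.

(** * Convergence of the extended flow *)

Section Convergence.
Context {R : realType} {N : nat} (T : triangulation N).
Variables (I : {set 'I_N} -> R) (alpha : R).
Hypothesis I_ge0 : forall e, e \in edges T -> 0 <= I e.
Hypothesis alpha_chi : alpha * (euler_char T)%:~R <= 0.

Let X : 'rV[R]_N -> 'I_N -> R := flow_field T I alpha.

Definition lnv (r : 'rV[R]_N) : 'rV[R]_N := \row_i ln (r 0 i).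

Lemma lnvK r : positive_vec r -> expv (lnv r) = r.
Proof. by move=> r0; apply/rowP => i; rewrite !mxE lnK// posrE. Qed.

Lemma ext_solution_solves b (r : R -> 'rV[R]_N) : (0 < b)%E ->
  ext_alpha_flow_solution T I alpha b r -> solves X b (fun t => lnv (r t)).
Proof.
move=> b0 [Dr Hr H0].
have lnE i : (fun s => lnv (r s) 0 i) = fun s => ln (r s 0 i).
  by apply/funext => s; rewrite mxE.
split=> [t i t0 tb|i].
  rewrite lnE /X /flow_field lnvK; first exact: Hr.
  exact: Dr (ltW t0) tb.
rewrite (_ : (fun h => _) = fun h => h^-1 * (ln (r h 0 i) - ln (r 0 0 i))).
  by rewrite /X /flow_field lnvK; [exact: H0|exact: Dr].
by apply/funext => h; rewrite !mxE.
Qed.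

Lemma solves_ext_solution b (u : R -> 'rV[R]_N) : solves X b u ->
  ext_alpha_flow_solution T I alpha b (fun t => expv (u t)).
Proof.
move=> [Hu H0].
have lnE s i : ln (expv (u s) 0 i) = u s 0 i by rewrite mxE expRK.
split=> [t _ _|t i t0 tb|i]; first exact: positive_expv.
  rewrite (_ : (fun s => _) = fun s => u s 0 i); first exact: Hu.
  by apply/funext => s; rewrite lnE.
rewrite (_ : (fun h => _) = fun h => h^-1 * (u h 0 i - u 0 0 i)); first exact: H0.
by apply/funext => h; rewrite !lnE.
Qed.

Lemma solution_ext_solution b (r : R -> 'rV[R]_N) : (0 < b)%E ->
  alpha_flow_solution T I alpha b r -> ext_alpha_flow_solution T I alpha b r.
Proof.
move=> b0 [Dr Hr H0].
have KE t i : 0 <= t -> (t%:E < b)%E ->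
    curvature T I (r t) i = ext_curvature T I (r t) i.
  move=> t0 tb; have [rp rO] := Dr t t0 tb.
  by rewrite -(lnvK rp) curvatureE// lnvK.
split=> [t t0 tb|t i t0 tb|i]; first by have [] := Dr t t0 tb.
  by rewrite -KE//; [exact: Hr|exact: ltW].
by rewrite -KE.
Qed.

Lemma flow_field_modulus (v : 'rV[R]_N) (e : R) : 0 < e ->
  exists2 d : R, 0 < d & forall w : 'rV[R]_N,
    (forall j, `|w 0 j - v 0 j| < d) -> forall i, `|X w i - X v i| <= e.
Proof.
move=> e0.
have C i : (fun w => X w i) @ nbhs v --> X v i.
  apply: (@cvg_flow_field R N T I alpha I_ge0 _ (nbhs v) _ id) => j.
  exact: coord_continuous.
suff [d d0 Hd] : exists2 d : R, 0 < d & forall i (w : 'rV[R]_N),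
    (forall j, `|w 0 j - v 0 j| < d) -> `|X w i - X v i| <= e.
  by exists d => // w Hw i; exact: Hd.
apply: uniform_pos => i.
have N1 : nbhs v [set w | `|X v i - X w i| <= e].
  by have /cvgrPdist_le/(_ _ e0) := C i.
have [d /= d0 Hd] := (@nbhs_ballP R 'rV[R]_N _ _).1 N1.
exists d => // d' d'0 d'd w Hw; rewrite distrC; apply: Hd; split=> // i0 j.
by rewrite /ball /= distrC ord1 (lt_le_trans (Hw j)).
Qed.

Lemma solves_exists (u0 : 'rV[R]_N) : exists2 u, u 0 = u0 & solves X +oo%E u.
Proof.
have [B B0 HB] := flow_field_bounded alpha I_ge0.
exact: flow_exists B0 HB flow_field_modulus.
Qed.

Lemma expR_sub1_le (z : R) : `|expR z - 1| <= expR `|z| * `|z|.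
Proof.
have h1 := expR_ge1Dx z; have h2 := expR_ge1Dx (- z).
have [z0|z0] := leP 0 z.
  have e1 : 0 <= expR z - 1 by lra.
  rewrite (ger0_norm z0) (ger0_norm e1).
  have := expR_gt0 z => e0.
  have : expR z * (1 - z) <= expR z * expR (- z).
    by apply: ler_wpM2l h2; exact: ltW.
  by rewrite -expRD subrr expR0; lra.
have e1 : expR z - 1 < 0 by rewrite subr_lt0 expR_lt1.
rewrite (ltr0_norm z0) (ltr0_norm e1).
have : 0 <= (expR (- z) - 1) * - z by rewrite mulr_ge0//; lra.
by lra.
Qed.

(** The limit is the given metric rescaled so as to have the same product of
    radii as the initial one. *)
Lemma exponential_limit (u : R -> 'rV[R]_N) (ustar : 'rV[R]_N) :
  constant_alpha_curvature T I alpha (expv ustar) -> solves X +oo%E u ->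
  exists2 rhat : 'rV[R]_N, constant_alpha_curvature T I alpha rhat &
    converges_exponentially (fun t => expv (u t)) rhat.
Proof.
move=> cstar Su.
have N0 : 0 < N%:R :> R by rewrite ltr0n (vertex_nonempty T).
pose a := (\sum_i u 0 0 i - \sum_i ustar 0 i) / N%:R.
pose w := shiftv ustar a.
have cw : constant_alpha_curvature T I alpha (expv w) by exact: constant_curvature_shift.
have Xw := flow_field_equilibrium I_ge0 cw.
have w_sum : \sum_i w 0 i = \sum_i u 0 0 i.
  under eq_bigr do rewrite mxE.
  by rewrite big_split /= sumr_const card_ord -[X in _ + X]mulr_natr divfK ?gt_eqF//; ring.
move: w cw Xw w_sum => w cw Xw w_sum {a}.
pose D := Num.sqrt (sqdist (u 0) w).
have D0 : 0 <= D := sqrtr_ge0 _.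
have coord_le (v : 'rV[R]_N) i : (v 0 i - w 0 i) ^+ 2 <= sqdist v w.
  by rewrite /sqdist (bigD1 i) //= lerDl; apply: sumr_ge0 => j _; exact: sqr_ge0.
have [c c0 Hc] := flow_field_coercive I_ge0 alpha_chi cw.1 D0.
have decay := flow_exponential
  (flow_field_dissipative I_ge0 alpha_chi) (flow_field_sum alpha I_ge0) Su Xw w_sum.
have {}decay : forall t, 0 <= t ->
    sqdist (u t) w <= sqdist (u 0) w * expR (- (2 * c * t)).
  apply: decay => v vle v0; apply: Hc => // i.
  by rewrite -sqrtr_sqr ler_wsqrtr// (le_trans (coord_le v i)).
have u_le (t : R) i : 0 <= t -> `|u t 0 i - w 0 i| <= D * expR (- (c * t)).
  move=> t0; rewrite -(@ler_pXn2r _ 2)// ?nnegrE ?mulr_ge0 ?expR_ge0//.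
  rewrite real_normK ?num_real// exprMn sqr_sqrtr ?sqdist_ge0// -expRM_natl.
  apply: le_trans (coord_le _ _) _; apply: le_trans (decay t t0) _.
  by rewrite (_ : 2%:R * - (c * t) = - (2 * c * t))//; ring.
exists (expv w) => //.
pose K i := expR (w 0 i) * expR D * D.
have K0 i : 0 <= K i by rewrite !mulr_ge0// expR_ge0.
exists (\sum_i K i + 1), c; split=> //; first by rewrite ltr_wpDl// sumr_ge0.
move=> t t0.
have E0 := expR_gt0 (- (c * t)).
rewrite [leLHS]/Num.Def.normr /= mx_normrE (bigmax_le _ _)//=.
  by rewrite mulr_ge0 ?(ltW E0)// addr_ge0// sumr_ge0.
move=> -[i0 i] _ /=; rewrite (ord1 i0) !mxE.
have -> : expR (u t 0 i) - expR (w 0 i) =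
    expR (w 0 i) * (expR (u t 0 i - w 0 i) - 1).
  by rewrite mulrBr -expRD mulr1 (addrC (w 0 i)) subrK.
have ui := u_le t i t0.
have uD : `|u t 0 i - w 0 i| <= D.
  apply: le_trans ui _; rewrite ler_piMr// expR_le1 oppr_le0.
  by rewrite mulr_ge0// ltW.
rewrite normrM (ger0_norm (expR_ge0 _)).
apply: (@le_trans _ _ (K i * expR (- (c * t)))); last first.
  rewrite ler_wpM2r ?(ltW E0)// (bigD1 i) //= -addrA lerDl addr_ge0//.
  by apply: sumr_ge0.
rewrite /K -!mulrA ler_wpM2l ?expR_ge0//.
apply: le_trans (expR_sub1_le _) _.
by rewrite ler_pM ?expR_ge0// ler_expR.
Qed.

End Convergence.

Unset Implicit Arguments.
Set Strict Implicit.

Theorem theorem6p2 (R : realType) (N : nat) (T : triangulation N)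
    (I : {set 'I_N} -> R) (alpha : R)
    (I_ge0 : forall e, e \in edges T -> 0 <= I e)
    (alpha_chi : alpha * (euler_char T)%:~R <= 0)
    (ex_const : exists rstar : 'rV[R]_N,
        constant_alpha_curvature T I alpha rstar) :
  (forall (b : \bar R) (r : R -> 'rV[R]_N),
      (0 < b)%E -> Omega T I (r 0) -> alpha_flow_solution T I alpha b r ->
      exists rext : R -> 'rV[R]_N,
        [/\ forall t : R, 0 <= t -> (t%:E < b)%E -> rext t = r t,
            ext_alpha_flow_solution T I alpha +oo%E rext
          & exists2 rhat : 'rV[R]_N, constant_alpha_curvature T I alpha rhat
              & converges_exponentially rext rhat]) /\
  (forall r : R -> 'rV[R]_N,
      ext_alpha_flow_solution T I alpha +oo%E r ->
      exists2 rhat : 'rV[R]_N, constant_alpha_curvature T I alpha rhat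
        & converges_exponentially r rhat).
Proof.
have [rstar cstar] := ex_const.
have {}cstar : constant_alpha_curvature T I alpha (expv (lnv rstar)).
  by rewrite lnvK//; case: cstar => -[].
split=> [b r b0 _ sol|r sol].
  have esol := solution_ext_solution b0 sol.
  have Sr := ext_solution_solves b0 esol.
  have [u u0 Su] := solves_exists alpha I_ge0 (lnv (r 0)).
  have Su_b : solves (flow_field T I alpha) b u.
    by split; [move=> t i t0 _; exact: (Su.1 t i t0 (ltry _))|exact: Su.2].
  exists (fun t => expv (u t)); split.
  - move=> t t0 tb.
    have dis := flow_field_dissipative I_ge0 alpha_chi.
    rewrite (flow_unique dis Su_b Sr u0 t0 tb) lnvK//.
    by have [+ _ _] := esol; exact.
  - exact: solves_ext_solution.
  - exact: exponential_limit cstar Su.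
have Sr := ext_solution_solves (ltry 0) sol.
have [rhat crhat [C [c [C0 c0 Hc]]]] := exponential_limit I_ge0 alpha_chi cstar Sr.
exists rhat => //; exists C, c; split=> // t t0.
rewrite -[r t](lnvK (r := r t)); first exact: Hc.
by have [+ _ _] := sol => /(_ t t0 (ltry _)).
Qed.
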